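(* Let $f:\mathbb{R}^n\to\mathbb{R}$ be differentiable at almost every point of $\mathbb{R}^n$ and suppose that $Mf\not\equiv\infty$. Then $Mf$ is differentiable at almost every point of $\mathbb{R}^n$.
   Context: $Mf(x)=\sup_{r>0}\frac{1}{|B(x,r)|}\int_{B(x,r)}|f(y)|\,dy$ is the (centered) Hardy-Littlewood maximal function, with values in $[0,\infty]$. ''Almost every'' refers to Lebesgue measure. *)

(* Defs.v *)
From HB Require Import structures.
From mathcomp Require Import all_boot all_order all_algebra.
From mathcomp Require Import all_classical all_reals all_analysis.

Set Implicit Arguments.
Unset Strict Implicit.
Unset Printing Implicit Defensive.

Import Order.TTheory GRing.Theory Num.Theory.
Import numFieldNormedType.Exports.

Local Open Scope classical_set_scope.
Local Open Scope ring_scope.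

Definition measure_rV_display : measure_display -> measure_display.
Proof. exact. Qed.

(* Product sigma-algebra, as for [n.-tuple T]. *)
Section measurable_rV.
Context {d} {T : sigmaRingType d} {n : nat}.

Let coors : 'I_n -> 'rV[T]_n -> T := fun i x => x ord0 i.

Let rV_set0 : g_sigma_preimage coors set0.
Proof. exact: sigma_algebra0. Qed.

Let rV_setC A : g_sigma_preimage coors A -> g_sigma_preimage coors (~` A).
Proof. exact: sigma_algebraC. Qed.

Let rV_bigcup (F : _^nat) : (forall i, g_sigma_preimage coors (F i)) ->
  g_sigma_preimage coors (\bigcup_i (F i)).
Proof. exact: sigma_algebra_bigcup. Qed.

HB.instance Definition _ := @isMeasurable.Build (measure_rV_display d)
  'rV[T]_n (g_sigma_preimage coors) rV_set0 rV_setC rV_bigcup.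

End measurable_rV.

Section rV_cons.
Context {d} {T : measurableType d} {n : nat}.

Definition rV_cons (p : T * 'rV[T]_n) : 'rV[T]_n.+1 :=
  \row_i oapp (p.2 ord0) p.1 (unlift ord0 i).

Let rV_uncons (x : 'rV[T]_n.+1) : T * 'rV[T]_n :=
  (x ord0 ord0, \row_i x ord0 (lift ord0 i)).

Let measurable_coord m (i : 'I_m) :
  measurable_fun [set: 'rV[T]_m] (fun x => x ord0 i).
Proof.
move=> _ Y mY; rewrite setTI; apply: sub_sigma_algebra => /=.
rewrite -bigcup_seq/=; exists i => /=; first by rewrite mem_index_enum.
by exists Y => //; rewrite setTI.
Qed.

Let measurable_fun_rV d' (T' : measurableType d') m (f : T' -> 'rV[T]_m) :
  (forall i, measurable_fun [set: T'] (fun t => f t ord0 i)) ->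
  measurable_fun [set: T'] f.
Proof.
move=> mf.
suff sf : g_sigma_preimage (fun (i : 'I_m) t => f t ord0 i) `<=` measurable.
  move=> _ A mA; apply: sf.
  rewrite (g_sigma_preimage_comp (fun (i : 'I_m) (x : 'rV[T]_m) => x ord0 i) f).
  by exists A.
apply: smallest_sub; first exact: sigma_algebra_measurable.
rewrite -bigcup_seq; apply: bigcup_sub => i _ A [B mB <-].
exact: mf.
Qed.

Lemma measurable_rV_cons : measurable_fun [set: T * 'rV[T]_n] rV_cons.
Proof.
apply: measurable_fun_rV => i.
case: (unliftP ord0 i) => [j ->|->].
  under eq_fun do rewrite mxE liftK/=.
  by apply: (measurableT_comp (measurable_coord j)); exact: measurable_snd.
by under eq_fun do rewrite mxE unlift_none/=; exact: measurable_fst.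
Qed.

Let measurable_rV_uncons : measurable_fun [set: 'rV[T]_n.+1] rV_uncons.
Proof.
apply/measurable_fun_pairP; split; first exact: measurable_coord.
apply: measurable_fun_rV => i; rewrite /comp/=.
by under eq_fun do rewrite mxE; exact: measurable_coord.
Qed.

Let rV_unconsK : cancel rV_uncons rV_cons.
Proof.
move=> x; apply/rowP => i; rewrite mxE.
by case: (unliftP ord0 i) => [j ->|->]/=; rewrite ?mxE.
Qed.

Let rV_consK : cancel rV_cons rV_uncons.
Proof.
move=> [t x]; congr pair; first by rewrite mxE unlift_none.
by apply/rowP => i; rewrite !mxE liftK.
Qed.

Context {R : realType}.
Variables (m1 : {sigma_finite_measure set T -> \bar R})
  (m2 : {sigma_finite_measure set 'rV[T]_n -> \bar R}).

Definition product_rV : set 'rV[T]_n.+1 -> \bar R :=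
  pushforward (m1 \x m2)%E rV_cons.

HB.instance Definition _ := Measure.copy product_rV
  (measure_function_pushforward__canonical__measure_function_Measure
     (m1 \x m2)%E measurable_rV_cons).

Let product_rV_sigma_finite : sigma_finite setT product_rV.
Proof.
have /sigma_finiteP[F [FT ndF Foo]] := sigma_finiteT m1.
have /sigma_finiteP[G [GT ndG Goo]] := sigma_finiteT m2.
exists (fun k => rV_uncons @^-1` (F k `*` G k)).
  apply/esym; rewrite -subTset => x _.
  have [k _ Fk] : (\bigcup_i F i) (rV_uncons x).1 by rewrite -FT.
  have [l _ Gl] : (\bigcup_i G i) (rV_uncons x).2 by rewrite -GT.
  exists (maxn k l) => //; split.
    by move: Fk; exact/subsetPset/ndF/leq_maxl.
  by move: Gl; exact/subsetPset/ndG/leq_maxr.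
move=> k; have [mF Fk] := Foo k; have [mG Gk] := Goo k; split.
  rewrite -[X in measurable X]setTI; apply: measurable_rV_uncons => //.
  exact: measurableX.
rewrite /product_rV /pushforward -comp_preimage.
rewrite (_ : _ \o _ = id) ?preimage_id; last exact/funext/rV_consK.
by rewrite product_measure1E// lte_mul_pinfty// ge0_fin_numE.
Qed.

HB.instance Definition _ :=
  Measure_isSigmaFinite.Build _ _ _ product_rV product_rV_sigma_finite.

End rV_cons.

Section lebesgue_rV.
Context {R : realType}.

Fixpoint borel_lebesgue_rV (n : nat) :
    {sigma_finite_measure set 'rV[measurableTypeR R]_n -> \bar R} :=
  if n is n'.+1 then product_rV lebesgue_measure (borel_lebesgue_rV n')
  else dirac ((0 : 'rV[R]_0) : 'rV[measurableTypeR R]_0).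

(* Lebesgue measure on the Lebesgue sigma-algebra of R^n: the Caratheodory
   completion of the n-fold product of [lebesgue_measure]. *)
Definition lebesgue_rV (n : nat) :=
  @completed_measure_extension _ _ _ (borel_lebesgue_rV n).
Arguments lebesgue_rV : clear implicits.

HB.instance Definition _ (n : nat) := Measure.on (lebesgue_rV n).

Let lebesgue_rV_sigma_finite (n : nat) : sigma_finite setT (lebesgue_rV n).
Proof. exact/completed_measure_extension_sigma_finite/sigma_finiteT. Qed.

HB.instance Definition _ (n : nat) := Measure_isSigmaFinite.Build _ _ _
  (lebesgue_rV n) (lebesgue_rV_sigma_finite n).

End lebesgue_rV.
Arguments lebesgue_rV {R} n.

Section maximal_function.
Context {R : realType} {n : nat}.
Implicit Types (f : 'rV[R]_n -> R) (x : 'rV[R]_n).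

(* The library's [ball] on 'rV[R]_n is the one of the sup norm. *)
Definition euclidean_ball x (r : R) : set 'rV[R]_n :=
  [set y | Num.sqrt (\sum_i (y ord0 i - x ord0 i) ^+ 2) < r].

Definition HL_maximal_rV f x : \bar R :=
  ereal_sup [set ((lebesgue_rV n (euclidean_ball x r))^-1 *
      \int[lebesgue_rV n]_(y in euclidean_ball x r) `|f y|%:E)%E
    | r in `]0, +oo[%classic].

(* For an extended-real-valued function, a first-order expansion at x with a
   real value at x forces finiteness near x. *)
Definition ereal_differentiable (g : 'rV[R]_n -> \bar R) x : Prop :=
  (\forall y \near x, g y \is a fin_num) /\ differentiable (fine \o g) x.

End maximal_function.

(* Main.v *)
(* Write F = |f|. At a point x where f is differentiable, F is Lipschitz at x, and so
   is Mf: if Mf(x) > F(x), only radii bounded away from 0 matter near x, and there the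
   inclusion B(y, r) in B(x, r + |x - y|) makes the averages Lipschitz in the centre; if
   Mf(x) = F(x), the same inclusion is applied to F - F(x) + 2 L r, which is nonnegative
   on B(x, 2 r) and has average at most 2 L r, so that its small size compensates for
   the factor (1 + |x - y| / r)^n - 1.

   Stepanov's theorem then gives differentiability almost everywhere. It follows
   (Maly) from Rademacher's theorem by squeezing Mf between countably many Lipschitz
   envelopes. Rademacher's theorem is proved by induction on the dimension, peeling off
   one coordinate at a time: a function with a derivative in the first coordinate and a
   differential p in the others is differentiable at x as soon as the set K of points
   having nearly the same differential p, at a fixed scale, satisfies
   dist(x + (a, 0), K) = o(a). This holds at almost every point of K because dist(., K)
   is Lipschitz, hence almost everywhere differentiable along the first coordinate, and
   vanishes on K. In dimension one, a nondecreasing Lipschitz function is the integral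
   of the Radon-Nikodym density of its Stieltjes measure. *)
From HB Require Import structures.
Require Import Defs.
From mathcomp Require Import all_boot all_order all_algebra.
From mathcomp Require Import all_classical all_reals all_analysis.
From mathcomp Require Import measurable_realfun ring lra.
Set Implicit Arguments.
Unset Strict Implicit.
Unset Printing Implicit Defensive.
Import Order.TTheory GRing.Theory Num.Theory.
Import numFieldNormedType.Exports.

Local Open Scope classical_set_scope.
Local Open Scope ring_scope.

(** * Lipschitz functions of one real variable *)

Lemma lipschitz_continuous_at (R : realType) (V : normedModType R) (g : V -> R) L :
  (forall x y, `|g x - g y| <= L * `|x - y|) -> continuous g.
Proof.
move=> gL x; apply/cvgrPdist_lt => e e0.
have L0 : 0 < `|L| + 1 by rewrite ltr_pwDr.
apply/nbhs_ballP; exists (e / (`|L| + 1)); first by rewrite /= divr_gt0.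
move=> y; rewrite -ball_normE /= ltr_pdivlMr// => xy.
rewrite (le_lt_trans (gL x y))// (le_lt_trans _ xy)// mulrC ler_wpM2l//.
by rewrite (le_trans (ler_norm _))// lerDl.
Qed.

Lemma ae_imp d (T : semiRingOfSetsType d) (R : realType) (mu : set T -> \bar R)
    (P Q : T -> Prop) :
  (forall x, P x -> Q x) -> {ae mu, forall x, P x} -> {ae mu, forall x, Q x}.
Proof.
move=> PQ [A [mA A0 PA]]; exists A; split => // x nQ; apply: PA => /PQ.
exact: nQ.
Qed.

Section monotone_lipschitz.
Context {R : realType}.
Local Notation mu := (@lebesgue_measure R).

(** The Stieltjes measures of [f] and [h] add up to [C] times Lebesgue measure: the two sides agree
    on half-open intervals, which determine them. Dropping the contribution of [h] leaves the
    inequality. *)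
Lemma stieltjes_le_lebesgue (f h : cumulative R R) (C : R) :
  0 <= C -> (forall x, f x + h x = C * x) ->
  forall A, measurable A -> (lebesgue_stieltjes_measure f A <= C%:E * mu A)%E.
Proof.
move=> C0 fh A mA.
pose m1 := lebesgue_stieltjes_measure f.
pose m2 := lebesgue_stieltjes_measure h.
pose m : {measure set (measurableTypeR R) -> \bar R} := measure_add m1 m2.
have mE B : m B = (m1 B + m2 B)%E by exact: measure_addE.
have nd : nondecreasing (fun x : R => C * x) by move=> x y xy; rewrite ler_wpM2l.
have rc : right_continuous (fun x : R => C * x).
  by apply: right_continuousW => x; exact: mulrl_continuous.
pose k : cumulative R R := HB.pack (fun x : R => C * x) (isCumulative.Build R _ R _ nd rc).
have mV X : ocitv X -> lebesgue_stieltjes_measure k X = m X.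
  move=> -[[a b] _ <-]; rewrite mE /m1 /m2 /lebesgue_stieltjes_measure/=.
  rewrite /measure_extension !measurable_mu_extE//=; try exact: is_ocitv.
  rewrite !wlength_itv/= lte_fin; case: ifP => ab; last by rewrite adde0.
  rewrite -!EFinB -EFinD; congr (_%:E).
  have := fh a; have := fh b; lra.
pose Cn : {nonneg R} := NngNum C0.
have kE X : ocitv X -> lebesgue_stieltjes_measure k X = mscale Cn mu X.
  move=> -[[a b] _ <-]; rewrite /mscale/= (lebesgue_measure_itv `]a, b])/=.
  rewrite /lebesgue_stieltjes_measure /measure_extension measurable_mu_extE//=; last exact: is_ocitv.
  rewrite !wlength_itv/= lte_fin; case: ifP => ab; last by rewrite mule0.
  by rewrite -!EFinB -EFinM mulrBr.
rewrite -[leRHS]/(mscale Cn mu A) -(lebesgue_stieltjes_measure_unique kE)//.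
by rewrite (lebesgue_stieltjes_measure_unique mV)// mE leeDl.
Qed.

Lemma monotone_lipschitz_derivable_ae (f : R -> R) (C : R) :
  (forall x y, x <= y -> f x <= f y <= f x + C * (y - x)) ->
  {ae mu, forall x, derivable f x 1}.
Proof.
move=> fC.
have C0 : 0 <= C by have := fC 0 1 ler01; lra.
have nd : nondecreasing f by move=> x y /fC /andP[].
have fL x y : `|f x - f y| <= C * `|x - y|.
  wlog xy : x y / x <= y.
    move=> H; have [/H//|/ltW/H] := leP x y.
    by rewrite distrC => /le_trans; apply; rewrite distrC.
  rewrite distrC [`|x - y|]distrC !ger0_norm ?subr_ge0// ?nd//.
  by have := fC _ _ xy; lra.
have rc : right_continuous f.
  by apply: right_continuousW; exact: (@lipschitz_continuous_at R R^o f C).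
pose h x := C * x - f x.
have hnd : nondecreasing h by move=> x y /fC; rewrite /h; lra.
have hrc : right_continuous h.
  apply: right_continuousW => x; apply: cvgB; first exact: mulrl_continuous.
  exact: (@lipschitz_continuous_at R R^o f C).
pose F : cumulative R R := HB.pack f (isCumulative.Build R _ R _ nd rc).
pose H : cumulative R R := HB.pack h (isCumulative.Build R _ R _ hnd hrc).
have FH x : F x + H x = C * x by rewrite /= /h; lra.
have leF := stieltjes_le_lebesgue C0 FH.
suff key (N : nat) : {ae mu, forall x, - N%:R < x -> x < N%:R -> derivable f x 1}.
  apply: ae_imp (ae_foralln key) => x Hx.
  have := archi_boundP (normr_ge0 x); set N := Num.bound _ => xN.
  by apply: (Hx N); move: xN; rewrite ltr_norml => /andP[].
(* Restricted to a bounded interval, the Stieltjes measure is finite and its density is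
   integrable. *)
pose D := `]-N%:R, N%:R]%classic : set (measurableTypeR R).
have mD : measurable D by exact: measurable_itv.
pose nuF := lebesgue_stieltjes_measure F.
have Doo : (nuF D < +oo)%E.
  rewrite (le_lt_trans (leF _ mD))// lebesgue_measure_itv/=.
  by case: ifP => _; rewrite ?mule0// -EFinB -EFinM ltry.
pose nu : {finite_measure set (measurableTypeR R) -> \bar R} := mfrestr mD Doo.
have nuE A : nu A = nuF (A `&` D) by [].
have numu : charge_of_finite_measure nu `<< mu.
  apply/null_content_dominatesP => A mA A0.
  apply/eqP; rewrite eq_le measure_ge0 andbT.
  have mAD : measurable (A `&` D) by exact: measurableI.
  rewrite [leLHS]/= nuE (le_trans (leF _ mAD))//.
  rewrite (_ : mu (A `&` D) = 0%E) ?mule0//; apply/eqP.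
  by rewrite eq_le measure_ge0 andbT -A0 le_measure// inE.
have [d dfin] : exists d : R -> R, mu.-integrable setT (EFin \o d) /\
    forall A, measurable A -> nu A = (\int[mu]_(x in A) (d x)%:E)%E.
  pose rn := Radon_Nikodym (charge_of_finite_measure nu) mu.
  have rnfin x : rn x \is a fin_num by exact: Radon_Nikodym_fin_num.
  exists (fine \o rn).
  have -> : EFin \o (fine \o rn) = rn by apply/funext => x /=; rewrite fineK.
  split; first exact: Radon_Nikodym_integrable.
  move=> A mA; transitivity (charge_of_finite_measure nu A) => //.
  rewrite (Radon_Nikodym_integral numu mA).
  by apply: eq_integral => x _ /=; rewrite fineK.
case: dfin => dint dE.
have ftc : {ae mu, forall x : R, (BRight (- N%:R) < BRight x)%O ->
    derivable (fun x : R => \int[mu]_(t in [set` Interval (BRight (- N%:R)) (BRight x)]) d t : R)%R x 1}.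
  have locd : locally_integrable setT d by exact: (open_integrable_locally openT).
  apply: ae_imp (@FTC1 R d (BRight (- N%:R)) _ locd) => [x Hx /Hx[]//|y].
  by apply: integrableS dint => //; exact: measurable_itv.
apply: ae_imp ftc => x Hx Nx xN.
have {Hx} dF := Hx _; have {}dF := dF ltac:(by rewrite bnd_simp).
(* The Stieltjes measure of the interval from [- N] (excluded) to [y] (included) is [f y - f (- N)],
   so [f] is an indefinite integral of the density plus a constant. *)
have near_eq : \forall y \near x, f y =
    (\int[mu]_(t in [set` Interval (BRight (- N%:R)) (BRight y)]) d t)%R + f (- N%:R).
  near=> y.
  have Ny : - N%:R < y by near: y; exact: lt_nbhsr.
  have yN : y < N%:R by near: y; exact: lt_nbhsl.
  rewrite /Rintegral -dE; last exact: measurable_itv.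
  rewrite nuE (_ : _ `&` D = `]-N%:R, y]%classic); last first.
    rewrite /D; apply/seteqP; split => z /=; rewrite !in_itv/=; first by case.
    by move=> /andP[Nz zy]; rewrite Nz zy (le_trans zy (ltW yN)).
  rewrite /nuF /lebesgue_stieltjes_measure /measure_extension measurable_mu_extE/=; last exact: is_ocitv.
  by rewrite wlength_itv/= lte_fin Ny -EFinB/= subrK.
apply: near_eq_derivable; first by near=> y; apply/esym; near: y; exact: near_eq.
apply: derivableD => //.
Unshelve. all: by end_near. Qed.

(** Adding [L * x] makes [g] nondecreasing, with slopes at most [2 * L]. *)
Lemma lipschitz_derivable_ae (g : R -> R) (L : R) :
  (forall x y, `|g x - g y| <= L * `|x - y|) ->
  {ae mu, forall x, derivable g x 1}.
Proof.
move=> gL; pose f x := g x + L * x.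
have fC x y : x <= y -> f x <= f y <= f x + (2 * L) * (y - x).
  move=> xy; have := gL y x; rewrite [`|y - x|]ger0_norm ?subr_ge0//= ler_norml /f; lra.
apply: ae_imp (monotone_lipschitz_derivable_ae fC) => x df.
rewrite (_ : g = f - (fun x => L * x)); last first.
  by apply/funext => y; rewrite /f !fctE; lra.
apply: derivableB => //; apply: derivableM => //.
Qed.
End monotone_lipschitz.

(** * First-order approximations with rational slopes *)

Lemma ex_natSinv_lt (R : realType) (e : R) : 0 < e -> exists k : nat, k.+1%:R^-1 < e.
Proof.
by move=> e0; have [k _ H] := near_infty_natSinv_lt (PosNum e0); exists k; exact: (H k (leqnn k)).
Qed.

Lemma ex_rat_lt (R : realType) (l e : R) : 0 < e -> exists q : rat, `|l - ratr q| < e.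
Proof.
move=> e0; have /rat_in_itvoo[q] : l - e < l + e by lra.
by rewrite in_itv/= => /andP[? ?]; exists q; rewrite ltr_norml; apply/andP; split; lra.
Qed.

Section rV_norm.
Context {R : realType} {n : nat}.
Implicit Types (x v : 'rV[R]_n).

Lemma rV_coord_le x i : `|x ord0 i| <= `|x|.
Proof.
rewrite [leRHS]/Num.norm /= mx_normrE; apply/bigmax_geP; right => /=.
by exists (ord0, i).
Qed.

Lemma rV_norm_le x (e : R) : 0 <= e -> (forall i, `|x ord0 i| <= e) -> `|x| <= e.
Proof.
move=> e0 xe; rewrite [leLHS]/Num.norm /= mx_normrE; apply/bigmax_leP; split => //.
by move=> [i j] _ /=; rewrite ord1.
Qed.

Lemma rV_norm_lt x (e : R) : 0 < e -> (forall i, `|x ord0 i| < e) -> `|x| < e.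
Proof.
move=> e0 xe; rewrite [ltLHS]/Num.norm /= mx_normrE; apply/bigmax_ltP; split => //.
by move=> [i j] _ /=; rewrite ord1.
Qed.

Lemma rV_rat_dense x (e : R) : 0 < e ->
  exists q : 'rV[rat]_n, `|x - map_mx ratr q| < e.
Proof.
move=> e0; have H i : exists q : rat, `|x ord0 i - ratr q| < e by exact: ex_rat_lt.
exists (\row_i (sval (cid (H i)))); apply: rV_norm_lt => // i; rewrite !mxE.
by case: cid.
Qed.

(** Rational coefficients give a countable family that is dense among the linear forms, so that
    unions over slopes are countable. *)
Definition qform (p : 'rV[rat]_n) (v : 'rV[R]_n) : R :=
  \sum_i ratr (p ord0 i) * v ord0 i.

End rV_norm.

Lemma norm_sum_le (R : realType) n (F G : 'I_n -> R) (e : R) :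
  (forall i, `|G i| <= e) -> `|\sum_i F i * G i| <= (\sum_i `|F i|) * e.
Proof.
move=> Ge; rewrite (le_trans (ler_norm_sum _ _ _))// mulr_suml ler_sum// => i _.
by rewrite normrM ler_wpM2l.
Qed.

(** With accuracy [j], slope [i] and scale [k] fixed, this set is closed for continuous [g]. The
    sets K of nearly constant differential in the proof of Rademacher's theorem have this form. *)
Definition approx_along (R : realType) (V W : normedModType R) (I : Type)
    (ell : I -> W -> R) (iota : W -> V) (g : V -> R) (j : nat) (i : I) (k : nat) : set V :=
  [set x | forall w : W, `|w| < k.+1%:R^-1 ->
    `|g (x + iota w) - g x - ell i w| <= j.+1%:R^-1 * `|w|].

(* Differentiability of [g] along [iota], without mention of the derivative: for a
   dense family [ell] of linear forms that is also countable, this set is Borel. *)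
Definition diff_along (R : realType) (V W : normedModType R) (I : Type)
    (ell : I -> W -> R) (iota : W -> V) (g : V -> R) : set V :=
  [set x | forall j, exists i k, approx_along ell iota g j i k x].

Section approx_along.
Context {R : realType} {V W : normedModType R} {I : countType}.
Variables (ell : I -> W -> R) (iota : W -> V) (g : V -> R).
Hypothesis gc : continuous g.

Lemma closed_approx_along j i k : closed (approx_along ell iota g j i k).
Proof.
rewrite (_ : approx_along _ _ _ _ _ _ =
  \bigcap_(w in [set w : W | `|w| < k.+1%:R^-1])
   [set x | `|g (x + iota w) - g x - ell i w| <= j.+1%:R^-1 * `|w|]); last first.
  by apply/seteqP; split => [x xA w|x xA w] wk; apply: xA.
apply: closed_bigI => w _.
rewrite (_ : [set _ | _] = (fun x => `|g (x + iota w) - g x - ell i w|) @^-1`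
  [set y | y <= j.+1%:R^-1 * `|w|])//.
apply: closed_comp; last exact: closed_le.
move=> x _; apply: (@continuous_comp _ _ _ (fun x => g (x + iota w) - g x - ell i w) Num.norm);
  last exact: norm_continuous.
apply: cvgB; last exact: cvg_cst.
apply: cvgB; last exact: gc.
apply: (@continuous_comp _ _ _ (fun x => x + iota w) g); last exact: gc.
by apply: cvgD; [exact: cvg_id|exact: cvg_cst].
Qed.

Lemma diff_alongE : diff_along ell iota g =
  \bigcap_j \bigcup_i \bigcup_k approx_along ell iota g j i k.
Proof.
apply/seteqP; split=> [x xA j _|x xA j].
  by have [i [k]] := xA j; exists i => //; exists k.
by have [i _ [k _]] := xA j Logic.I; exists i, k.
Qed.

End approx_along.

(** * Borel sets of R^n *)

Section measurable_rV.
Context {R : realType} {n : nat}.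
Local Notation T := 'rV[measurableTypeR R]_n.

Lemma measurable_rV_coord (i : 'I_n) :
  measurable_fun [set: T] (fun x => x ord0 i).
Proof.
move=> _ Y mY; rewrite setTI; apply: sub_sigma_algebra => /=.
rewrite -bigcup_seq/=; exists i => /=; first by rewrite mem_index_enum.
by exists Y => //; rewrite setTI.
Qed.

Lemma measurable_rV_ball (x : 'rV[R]_n) (e : R) : measurable (ball x e : set T).
Proof.
have [e0|e0] := leP e 0.
  rewrite (_ : ball x e = set0 :> set 'rV[R]_n) //.
  by rewrite -ball_normE; apply/seteqP; split => // y /=; have := normr_ge0 (x - y); lra.
rewrite (_ : ball x e = \bigcap_(i in [set: 'I_n])
   ((fun y : T => y ord0 i) @^-1` (ball (x ord0 i) e : set R))); last first.
  rewrite -!ball_normE; apply/seteqP; split => [y /= xy i _|y xy].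
    by rewrite /ball_/=; have := rV_coord_le (x - y) i; rewrite !mxE; lra.
  by apply: rV_norm_lt => // i; rewrite !mxE; exact: (xy i).
apply: fin_bigcap_measurable => [|i _]; first exact: finite_finset.
rewrite -[X in measurable X]setTI.
by apply: measurable_rV_coord => //; rewrite ball_itv; exact: measurable_itv.
Qed.

Lemma open_measurable_rV (A : set 'rV[R]_n) : open A -> measurable (A : set T).
Proof.
move=> oA.
pose D := [set p : 'rV[rat]_n * nat | ball (map_mx ratr p.1 : 'rV[R]_n) p.2.+1%:R^-1 `<=` A].
rewrite (_ : A = \bigcup_(p in D) (ball (map_mx ratr p.1 : 'rV[R]_n) p.2.+1%:R^-1 : set T)).
  rewrite bigcup_mkcond; apply: countable_bigcupT_measurable => // p.
  by case: ifP => _ //; exact: measurable_rV_ball.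
apply/seteqP; split => [x Ax|x [p Dp]]; last exact: Dp.
have /nbhs_ballP[e /= e0 eA] := open_nbhs_nbhs (conj oA Ax).
(* A ball of radius below [e / 2] that contains [x] stays inside [ball x e]. *)
have [k ke] := ex_natSinv_lt (divr_gt0 e0 (ltr0n R 2)).
have k0 : (0 : R) < k.+1%:R^-1 by rewrite invr_gt0.
have [q qx] := rV_rat_dense x k0.
exists (q, k); last by rewrite -ball_normE /= distrC.
move=> y; rewrite -ball_normE /= => qy; apply: eA; rewrite -ball_normE /=.
rewrite (le_lt_trans (ler_distD (map_mx ratr q) _ _))// (splitr e).
by rewrite ltrD// (lt_trans _ ke).
Qed.

Lemma closed_measurable_rV (A : set 'rV[R]_n) : closed A -> measurable (A : set T).
Proof.
by move=> cA; rewrite -[A]setCK; apply: measurableC; apply: open_measurable_rV; exact: closed_openC.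
Qed.

Lemma measurable_diff_along (W : normedModType R) (I : countType)
    (ell : I -> W -> R) (iota : W -> 'rV[R]_n) (g : 'rV[R]_n -> R) :
  continuous g -> measurable (diff_along ell iota g : set T).
Proof.
move=> gc; rewrite diff_alongE; apply: bigcapT_measurable => j.
apply: countable_bigcupT_measurable => // i; apply: bigcupT_measurable => k.
by apply: closed_measurable_rV; exact: closed_approx_along.
Qed.

End measurable_rV.

(** * Rademacher's theorem *)

Lemma negligible_countable_bigcup d (T : sigmaRingType d) (R : realFieldType)
    (mu : {measure set T -> \bar R}) (I : countType) (F : I -> set T) :
  (forall i, mu.-negligible (F i)) -> mu.-negligible (\bigcup_i F i).
Proof.
move=> nF; have -> : \bigcup_i F i =
    \bigcup_m (if unpickle m is Some i then F i else set0).
  apply/seteqP; split => [x [i _ Fx]|x [m _]]; first by exists (pickle i); rewrite ?pickleK.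
  by case: unpickle => // i Fx; exists i.
by apply: negligible_bigcup => m; case: unpickle => // ; exact: negligible_set0.
Qed.

(** * Distance to a set *)

Section dist_to.
Context {R : realType} {V : normedModType R}.
Variable K : set V.

(** For empty [K] this is the constant 0, the value of [inf set0], so the Lipschitz bound holds for
    every [K]. *)
Definition dist_to (x : V) : R := inf [set `|x - y| | y in K].

Let lb0 x : lbound [set `|x - y| | y in K] 0.
Proof. by move=> _ [y _ <-]. Qed.

Lemma dist_to_ge0 x : 0 <= dist_to x.
Proof.
have [K0|/set0P K0] := eqVneq K set0; first by rewrite /dist_to K0 image_set0 inf0.
by apply: lb_le_inf => //; case: K0 => y Ky; exists `|x - y|, y.
Qed.

Lemma dist_to_le x y : K y -> dist_to x <= `|x - y|.
Proof. by move=> Ky; apply: ge_inf; [exists 0; exact: lb0|exists y]. Qed.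

Lemma dist_to_eq0 x : K x -> dist_to x = 0.
Proof.
move=> Kx; apply/eqP; rewrite eq_le dist_to_ge0 andbT.
by rewrite (le_trans (dist_to_le x Kx))// subrr normr0.
Qed.

Lemma dist_to_lt x e : K !=set0 -> dist_to x < e -> exists2 y, K y & `|x - y| < e.
Proof.
move=> [z Kz] xe; have [|_ [y Ky <-] xy] := inf_lt _ xe; last by exists y.
by exists `|x - z|, z.
Qed.

Lemma dist_to_lipschitz x y : `|dist_to x - dist_to y| <= 1 * `|x - y|.
Proof.
have [K0|/set0P K0] := eqVneq K set0.
  by rewrite /dist_to K0 !image_set0 inf0 subrr normr0 mul1r.
suff H a b : dist_to a <= dist_to b + `|a - b|.
  by rewrite mul1r ler_norml; have := H x y; have := H y x; rewrite [`|y - x|]distrC; lra.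
apply/ler_addgt0Pr => e e0.
have [z Kz bz] : exists2 z, K z & `|b - z| < dist_to b + e.
  by apply: dist_to_lt => //; rewrite ltrDl.
by have := dist_to_le a Kz; have := ler_distD b a z; lra.
Qed.

End dist_to.

(** * Splitting off the first coordinate, and null sets by slices *)

Section cons_rV.
Context {R : realType} {n : nat}.

Definition cons_rV (s : R) (t : 'rV[R]_n) : 'rV[R]_n.+1 :=
  @rV_cons _ (measurableTypeR R) n (s, t).

Lemma cons_rV0 s t : cons_rV s t ord0 ord0 = s.
Proof. by rewrite mxE unlift_none. Qed.

Lemma cons_rVS s t i : cons_rV s t ord0 (lift ord0 i) = t ord0 i.
Proof. by rewrite mxE liftK. Qed.

Lemma cons_rV_surj x : exists s t, x = cons_rV s t.
Proof.
exists (x ord0 ord0), (\row_i x ord0 (lift ord0 i)); apply/rowP => i.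
by case: (unliftP ord0 i) => [j ->|->]; rewrite ?cons_rV0 ?cons_rVS ?mxE.
Qed.

Lemma cons_rVD s t s' t' : cons_rV s t + cons_rV s' t' = cons_rV (s + s') (t + t').
Proof.
apply/rowP => i.
by case: (unliftP ord0 i) => [j ->|->]; rewrite mxE ?cons_rV0 ?cons_rVS ?mxE.
Qed.

Lemma norm_cons_rV_le s t (e : R) : 0 <= e -> `|s| <= e -> `|t| <= e -> `|cons_rV s t| <= e.
Proof.
move=> e0 se te; apply: rV_norm_le => // i.
case: (unliftP ord0 i) => [j ->|->]; rewrite ?cons_rV0 ?cons_rVS//.
by rewrite (le_trans (rV_coord_le _ _)).
Qed.

Lemma le_norm_cons_rV s t : `|s| <= `|cons_rV s t| /\ `|t| <= `|cons_rV s t|.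
Proof.
split; first by rewrite -[in leLHS](cons_rV0 s t) rV_coord_le.
by apply: rV_norm_le => // i; rewrite -[in leLHS](cons_rVS s t) rV_coord_le.
Qed.

Definition head_incl (a : R) := cons_rV a 0.
Definition tail_incl (b : 'rV[R]_n) := cons_rV 0 b.

Lemma qform_cons (p0 : rat) (p : 'rV[rat]_n) s t :
  qform (\row_i oapp (p ord0) p0 (unlift ord0 i)) (cons_rV s t) =
  ratr p0 * s + qform p t :> R.
Proof.
rewrite /qform big_ord_recl mxE unlift_none cons_rV0; congr (_ + _).
by apply: eq_bigr => i _; rewrite mxE liftK cons_rVS.
Qed.

Lemma borel_lebesgue_rV_null_tail (A : set 'rV[measurableTypeR R]_n.+1) : measurable A ->
  (forall s, (borel_lebesgue_rV n).-negligible [set t | A (cons_rV s t)]) ->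
  (borel_lebesgue_rV n.+1).-negligible A.
Proof.
have xE s B : xsection (rV_cons @^-1` B) s = [set t | B (cons_rV s t)].
  by apply/seteqP; split => t; rewrite /xsection /= inE.
move=> mA A0; have mB : measurable (rV_cons @^-1` A : set (measurableTypeR R * 'rV[measurableTypeR R]_n)).
  by rewrite -[X in measurable X]setTI; exact: measurable_rV_cons.
apply/negligibleP => //; rewrite /= /product_rV /pushforward.
rewrite /product_measure1 integral0_eq// => s _ /=.
apply/negligibleP; first exact: measurable_xsection.
by rewrite xE; exact: A0.
Qed.

Lemma borel_lebesgue_rV_null_head (A : set 'rV[measurableTypeR R]_n.+1) : measurable A ->
  (forall t, lebesgue_measure.-negligible [set s | A (cons_rV s t)]) ->
  (borel_lebesgue_rV n.+1).-negligible A.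
Proof.
have yE t B : ysection (rV_cons @^-1` B) t = [set s | B (cons_rV s t)].
  by apply/seteqP; split => s; rewrite /ysection /= inE.
move=> mA A0; have mB : measurable (rV_cons @^-1` A : set (measurableTypeR R * 'rV[measurableTypeR R]_n)).
  by rewrite -[X in measurable X]setTI; exact: measurable_rV_cons.
apply/negligibleP => //; rewrite /= /product_rV /pushforward.
(* Slices in the first coordinate call for the other iterated integral; it defines the same measure,
   since both agree on rectangles. *)
transitivity ((lebesgue_measure \x^ borel_lebesgue_rV n) (rV_cons @^-1` A))%E.
  by apply: product_measure_unique => //= *; rewrite product_measure2E.
rewrite /product_measure2 integral0_eq// => t _ /=.
apply/negligibleP; first exact: measurable_ysection.
by rewrite yE; exact: A0.
Qed.

End cons_rV.

Definition qmul (R : realType) (q : rat) (a : R) : R := ratr q * a.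

(** [G1] to [G5] stand for the values of [g] at x + (a, b), z + (0, b), z, x + (a, 0) and x, where z
    is a point of K at distance [X] from x + (a, 0). Two Lipschitz errors of at most
    [3 * eta * L * W] and two approximation errors of at most [eta * W] give the factor
    [6 * L + 2]. *)
Lemma first_order_chain (R : realFieldType) (L X eta A B W J P Q G1 G2 G3 G4 G5 : R) :
  `|G1 - G2| <= L * X -> `|G2 - G3 - P| <= eta * B -> `|G4 - G3| <= L * X ->
  `|G4 - G5 - Q| <= eta * A -> X <= 3 * eta * W -> A <= W -> B <= W -> 0 <= W ->
  0 <= L -> 0 < eta -> eta * (6 * L + 2) <= J -> `|G1 - G5 - (Q + P)| <= J * W.
Proof.
rewrite !ler_norml => E1 E2 E3 E4 XW AW BW W0 L0 eta0 etaJ.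
have := ler_wpM2l L0 XW; have := ler_wpM2l (ltW eta0) AW.
have := ler_wpM2l (ltW eta0) BW; have := ler_wpM2r W0 etaJ.
move=> *; apply/andP; split; lra.
Qed.

(** The tail increment at x + (a, 0) is traded for the one at a nearby point of K, where the slope
    [p] is accurate at the same scale; the last hypothesis supplies such a point. *)
Lemma diff_along_cons (R : realType) n (g : 'rV[R]_n.+1 -> R) (L : R) x :
  0 <= L -> (forall x y, `|g x - g y| <= L * `|x - y|) ->
  diff_along (@qmul R) head_incl g x -> diff_along qform tail_incl g x ->
  (forall j p k, approx_along qform tail_incl g j p k x ->
    diff_along (@qmul R) head_incl (dist_to (approx_along qform tail_incl g j p k)) x) ->
  diff_along qform idfun g x.
Proof.
move=> L0 gL H1 H2 H3 j.
have [j' jj'] : exists j' : nat, j'.+1%:R^-1 < j.+1%:R^-1 / (6 * L + 2).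
  by apply: ex_natSinv_lt; rewrite divr_gt0 ?invr_gt0//; lra.
have [q [k1 gq]] := H1 j'; have [p [k2 gp]] := H2 j'.
have [q' [k3 dq]] := H3 _ _ _ gp j'.
pose eta : R := j'.+1%:R^-1; rewrite -/eta in jj'.
have eta0 : 0 < eta by rewrite invr_gt0.
set K := approx_along qform tail_incl g j' p k2 in dq.
exists (\row_i oapp (p ord0) q (unlift ord0 i)), (maxn k1 (maxn k2 k3)) => w wk.
have [a [b wE]] := cons_rV_surj w.
have [aw bw] := le_norm_cons_rV a b; rewrite -wE in aw bw.
have wlt k : (k <= maxn k1 (maxn k2 k3))%N -> `|w| < k.+1%:R^-1.
  by move=> kk; rewrite (lt_le_trans wk)// lef_pV2 ?posrE// ler_nat.
have w1 : `|w| < k1.+1%:R^-1 by apply: wlt; rewrite leq_max leqnn.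
have w2 : `|w| < k2.+1%:R^-1 by apply: wlt; rewrite !leq_max leqnn orbT.
have w3 : `|w| < k3.+1%:R^-1 by apply: wlt; rewrite !leq_max leqnn !orbT.
rewrite wE qform_cons -wE /=.
have [z Kz xz] : exists2 z, K z & `|x + head_incl a - z| <= 3 * eta * `|w|.
  have [a0|a0] := eqVneq a 0.
    exists x => //; rewrite a0.
    rewrite (_ : head_incl 0 = 0); first by rewrite addr0 subrr normr0 !mulr_ge0// ltW.
    by apply/rowP => i; case: (unliftP ord0 i) => [i' ->|->]; rewrite ?cons_rV0 ?cons_rVS !mxE.
  have ap : 0 < `|a| by rewrite normr_gt0.
  have [z Kz xz] : exists2 z, K z & `|x + head_incl a - z| < 3 * eta * `|a|.
    apply: dist_to_lt; first by exists x.
    (* The distance vanishes at x and is nonnegative at x - (a, 0), so its slope satisfies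
       [qmul q' a <= eta * |a|]. At x + (a, 0) the distance is then at most [2 * eta * |a|],
       strictly below [3 * eta * |a|] because [a] is nonzero. *)
    have := dq a (le_lt_trans aw w3).
    have := dq (- a); rewrite normrN => /(_ (le_lt_trans aw w3)).
    rewrite (dist_to_eq0 gp) /qmul !subr0 mulrN -/eta !ler_norml.
    have := dist_to_ge0 K (x + head_incl (- a)).
    have : 0 < eta * `|a| by rewrite mulr_gt0.
    lra.
  exists z => //; rewrite (le_trans (ltW xz))// ler_wpM2l// mulr_ge0// ltW//.
have E1 := gL (x + head_incl a + tail_incl b) (z + tail_incl b).
have E2 := Kz b (le_lt_trans bw w2).
have E3 := gL z (x + head_incl a).
have E4 := gq a (le_lt_trans aw w1).
have wab : x + w = x + head_incl a + tail_incl b.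
  by rewrite -addrA cons_rVD addr0 add0r wE.
have xab : x + head_incl a + tail_incl b - (z + tail_incl b) = x + head_incl a - z.
  by rewrite opprD addrACA subrr addr0.
move: E1; rewrite xab -wab => E1.
move: E3; rewrite distrC [`|z - _|]distrC => E3.
by apply: (first_order_chain E1 E2 E3 E4 xz) => //; rewrite -ler_pdivlMr ?ltW//; lra.
Qed.

Section rademacher.
Context {R : realType}.

Lemma derivable_diff_along (g : R -> R) x :
  derivable g x 1 -> diff_along (@qmul R) idfun g x.
Proof.
move=> dg j; have j0 : 0 < j.+1%:R^-1 / 2 :> R by rewrite divr_gt0 ?invr_gt0.
move: dg => /cvg_ex[/= l] /cvgrPdist_lt/(_ _ j0)/nbhs_ballP[d /= d0 dH].
have [q ql] := ex_rat_lt l j0.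
have [k kd] := ex_natSinv_lt d0.
exists q, k => w wk; have [->|w0] := eqVneq w 0.
  by rewrite addr0 subrr /qmul mulr0 subr0 normr0 mulr0.
have {dH} := dH w; rewrite -ball_normE /= sub0r normrN => /(_ (lt_trans wk kd) w0).
rewrite /GRing.scale/= mulr1 [w + x]addrC; set D := g (x + w) - g x => Dl.
have -> : D - qmul q w = (w^-1 * D - ratr q) * w.
  by rewrite /qmul mulrBl [in RHS]mulrAC (@mulVf R w w0) mul1r.
rewrite normrM ler_wpM2r// (le_trans (ler_distD l _ _))//.
by rewrite [leRHS]splitr lerD// ltW// distrC.
Qed.

(** On each line parallel to the first axis [g] is a Lipschitz function of one variable; Tonelli's
    theorem assembles the null sets. *)
Lemma negligible_head n (g : 'rV[R]_n.+1 -> R) L :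
  (forall x y, `|g x - g y| <= L * `|x - y|) ->
  (borel_lebesgue_rV n.+1).-negligible (~` diff_along (@qmul R) head_incl g).
Proof.
move=> gL; have gc := lipschitz_continuous_at gL.
apply: borel_lebesgue_rV_null_head => [|t].
  by apply: measurableC; exact: measurable_diff_along.
pose h s := g (cons_rV s t).
have hL s s' : `|h s - h s'| <= `|L| * `|s - s'|.
  rewrite (le_trans (gL _ _))// (le_trans (ler_wpM2r _ (ler_norm L)))// ler_wpM2l//.
  rewrite (_ : cons_rV s t - cons_rV s' t = cons_rV (s - s') 0).
    by apply: norm_cons_rV_le; rewrite ?normr0.
  by apply/eqP; rewrite subr_eq cons_rVD subrK add0r.
have [A [mA A0 hA]] := lipschitz_derivable_ae hL.
exists A; split => // s /= nD; apply: hA => /= dh; apply: nD => j.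
have [q [k H]] := derivable_diff_along dh j; exists q, k => a ak.
by have := H a ak; rewrite /h /head_incl cons_rVD addr0.
Qed.

Theorem rademacher n (g : 'rV[R]_n -> R) L :
  (forall x y, `|g x - g y| <= L * `|x - y|) ->
  (borel_lebesgue_rV n).-negligible (~` diff_along qform idfun g).
Proof.
elim: n g L => [|n IH] g L gL.
  rewrite (_ : ~` _ = set0); first exact: negligible_set0.
  apply/seteqP; split => // x /=; apply => j.
  exists 0, 0%N => w _; rewrite (_ : idfun w = 0); last by apply/rowP => -[].
  by rewrite addr0 subrr sub0r normrN /qform big_ord0 normr0 mulr_ge0// invr_ge0.
have gc := lipschitz_continuous_at gL.
have gL' x y : `|g x - g y| <= `|L| * `|x - y|.
  by rewrite (le_trans (gL _ _))// ler_wpM2r// ler_norm.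
(* Accuracy, slope and scale range over a countable type, so only countably many distance functions,
   all 1-Lipschitz, have to be differentiated along the first axis. *)
pose dK (i : nat * 'rV[rat]_n * nat) := dist_to (approx_along qform tail_incl g i.1.1 i.1.2 i.2).
suff key : (borel_lebesgue_rV n.+1).-negligible (~` diff_along (@qmul R) head_incl g `|`
  (~` diff_along qform tail_incl g `|`
   \bigcup_i (~` diff_along (@qmul R) head_incl (dK i)))).
  apply: negligibleS key => x nx; apply: contrapT => H; apply: nx.
  apply: (diff_along_cons _ gL').
  - exact: normr_ge0.
  - by apply: contrapT => H1; apply: H; left.
  - by apply: contrapT => H1; apply: H; right; left.
  - move=> j p k _; apply: contrapT => H1; apply: H; right; right.
    by exists (j, p, k).
apply: negligibleU; first exact: negligible_head gL.
apply: negligibleU; last first.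
  apply: negligible_countable_bigcup => i.
  exact: negligible_head (dist_to_lipschitz _).
apply: borel_lebesgue_rV_null_tail => [|s].
  by apply: measurableC; exact: measurable_diff_along.
have hL t t' : `|g (cons_rV s t) - g (cons_rV s t')| <= `|L| * `|t - t'|.
  rewrite (le_trans (gL' _ _))// ler_wpM2l//.
  rewrite (_ : cons_rV s t - cons_rV s t' = cons_rV 0 (t - t')).
    by apply: norm_cons_rV_le; rewrite ?normr0.
  by apply/eqP; rewrite subr_eq cons_rVD subrK add0r.
apply: negligibleS (IH _ _ hL) => t /= nD H; apply: nD => j.
have [p [k pk]] := H j; exists p, k => b bk.
by have := pk b bk; rewrite /tail_incl cons_rVD addr0.
Qed.
End rademacher.

(** * Stepanov's theorem *)

Section rform.
Context {R : realType} {n : nat}.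
Variable P : 'I_n -> R.

Definition rform (v : 'rV[R]_n) : R := \sum_i P i * v ord0 i.

Let rform_linear : linear rform.
Proof.
move=> a u v; rewrite /rform /GRing.scale/= mulr_sumr -big_split/=.
by apply: eq_bigr => i _; rewrite !mxE; ring.
Qed.

HB.instance Definition _ := GRing.isLinear.Build R 'rV[R]_n R _ rform rform_linear.

Lemma rform_continuous : continuous rform.
Proof.
apply: (@lipschitz_continuous_at R _ _ (\sum_i `|P i|)) => x y.
rewrite -[rform x - rform y]/(rform x - rform y) -linearB.
by apply: norm_sum_le => i; exact: rV_coord_le.
Qed.

End rform.

Lemma linear_approx_differentiable (R : realType) (V W : normedModType R) (f : V -> W)
    (df : {linear V -> W}) x :
  continuous df ->
  (forall e, 0 < e -> \forall h \near 0, `|f (x + h) - f x - df h| <= e * `|h|) ->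
  differentiable f x.
Proof.
move=> dfc dfo.
have H : f \o shift x = cst (f x) + df +o_ 0 id.
  apply/eqaddoP => e /dfo; apply: filterS => h /=.
  by rewrite !fctE /= opprD addrA [h + x]addrC.
by apply/diff_locallyP; rewrite (diff_unique dfc H).
Qed.

(** In each coordinate, the intervals of radius [j.+1%:R^-1] around the rational slopes meet
    pairwise, so the supremum of their left endpoints lies in all of them. These suprema are the
    coefficients of the differential. *)
Lemma diff_along_differentiable (R : realType) n (g : 'rV[R]_n -> R) x :
  diff_along qform idfun g x -> differentiable g x.
Proof.
move=> dg.
have [p pP] := @boolp.choice _ _ (fun j q => exists k, approx_along qform idfun g j q k x) dg.
have pp i j l : ratr (p j ord0 i) - j.+1%:R^-1 <= ratr (p l ord0 i) + l.+1%:R^-1 :> R.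
  have [k1 H1] := pP j; have [k2 H2] := pP l.
  (* Both approximations are tested on [d] times the [i]-th basis vector; [.+2] puts [d] strictly
     below both scales. *)
  pose d : R := (maxn k1 k2).+2%:R^-1.
  have d0 : 0 < d by rewrite invr_gt0.
  have dk k : (k <= maxn k1 k2)%N -> d < k.+1%:R^-1.
    by move=> kk; rewrite ltf_pV2 ?posrE// ltr_nat.
  pose v : 'rV[R]_n := \row_m (if m == i then d else 0).
  have vd : `|v| <= d.
    apply: rV_norm_le => [|m]; first exact: ltW.
    by rewrite mxE; case: ifP => _; rewrite ?normr0 ?ger0_norm// ltW.
  have qv (q : 'rV[rat]_n) : qform q v = ratr (q ord0 i) * d.
    rewrite /qform (bigD1 i)//= big1 ?addr0 ?mxE ?eqxx// => m mi.
    by rewrite mxE (negbTE mi) mulr0.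
  have := H1 v (le_lt_trans vd (dk _ (leq_maxl _ _))).
  have := H2 v (le_lt_trans vd (dk _ (leq_maxr _ _))).
  rewrite !qv /=.
  have : j.+1%:R^-1 * `|v| <= j.+1%:R^-1 * d by rewrite ler_wpM2l// invr_ge0.
  have : l.+1%:R^-1 * `|v| <= l.+1%:R^-1 * d by rewrite ler_wpM2l// invr_ge0.
  move=> A1 A2 /le_trans/(_ A1) A3 /le_trans/(_ A2) A4.
  rewrite -(ler_pM2r d0) mulrBl mulrDl.
  move: A3 A4; rewrite !ler_norml.
  move: (g (x + v)) (g x) (_ * d) (_ * d) (_ * d) (_ * d) => *; lra.
pose S i := [set (ratr (p j ord0 i) - j.+1%:R^-1 : R) | j in [set: nat]].
have PS i j : `|sup (S i) - ratr (p j ord0 i)| <= j.+1%:R^-1.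
  have Sj : S i (ratr (p j ord0 i) - j.+1%:R^-1) by exists j.
  have ubS l : ubound (S i) (ratr (p l ord0 i) + l.+1%:R^-1) by move=> _ [m _ <-].
  have h1 : ratr (p j ord0 i) - j.+1%:R^-1 <= sup (S i).
    by apply: ub_le_sup => //; exists (ratr (p j ord0 i) + j.+1%:R^-1).
  have h2 : sup (S i) <= ratr (p j ord0 i) + j.+1%:R^-1.
    by apply: ge_sup => //; exists (ratr (p j ord0 i) - j.+1%:R^-1).
  by rewrite ler_distl h1 h2.
apply: (linear_approx_differentiable (df := rform (fun i => sup (S i)))).
  exact: rform_continuous.
move=> e e0.
(* One error for each of the [n] coefficients and one for the approximation itself, whence
   [n%:R + 1]. *)
have [j je] : exists j : nat, j.+1%:R^-1 < e / (n%:R + 1).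
  by apply: ex_natSinv_lt; rewrite divr_gt0 ?ltr_wpDl.
have [k Hk] := pP j.
apply/nbhs_ballP; exists k.+1%:R^-1; first by rewrite /= invr_gt0.
move=> v; rewrite -ball_normE /= sub0r normrN => /Hk /= h1.
have h2 : `|qform (p j) v - rform (fun i => sup (S i)) v| <= n%:R * j.+1%:R^-1 * `|v|.
  rewrite distrC /rform /qform -sumrB.
  under eq_bigr do rewrite -mulrBl.
  rewrite (le_trans (norm_sum_le _ (rV_coord_le v)))// ler_wpM2r//.
  rewrite (le_trans (ler_sum _ (fun i _ => PS i j)))// sumr_const card_ord.
  by rewrite mulr_natl.
rewrite (_ : g (x + v) - g x - _ = (g (x + v) - g x - qform (p j) v) +
  (qform (p j) v - rform (fun i => sup (S i)) v)); last by rewrite addrA subrK.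
rewrite (le_trans (ler_normD _ _))// (le_trans (lerD h1 h2))// -mulrDl ler_wpM2r//.
rewrite -[X in X + _]mul1r -mulrDl addrC mulrC -ler_pdivlMr ?ltr_wpDl//.
by rewrite ltW// addrC.
Qed.

(** * Lipschitz envelopes *)

Section sup_conv.
Context {R : realType} {V : normedModType R}.
Variables (g : V -> R) (U : set V) (l : R).

(** For [0 <= l] and finite suprema, this is the least [l]-Lipschitz function lying above [g] on
    [U]. *)
Definition sup_conv (x : V) : R := sup [set g y - l * `|x - y| | y in U].

(** If the supremum exists at one point, it exists at every point. Otherwise the envelope is
    constant, equal to the default value 0 of [sup]. *)
Lemma sup_conv_lipschitz x y : 0 <= l -> `|sup_conv x - sup_conv y| <= l * `|x - y|.
Proof.
move=> l0; pose S x := [set g y - l * `|x - y| | y in U].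
have leS a b z : g z - l * `|a - z| <= g z - l * `|b - z| + l * `|a - b|.
  have := ler_wpM2l l0 (ler_distD a b z); rewrite [`|b - a|]distrC; lra.
have hS a b : has_sup (S a) -> has_sup (S b) /\ sup (S a) <= sup (S b) + l * `|a - b|.
  move=> [[_ [z Uz _]] [M aM]].
  have hb : has_sup (S b).
    split; first by exists (g z - l * `|b - z|), z.
    exists (M + l * `|b - a|) => _ [w Uw <-].
    rewrite (le_trans (leS b a w))// lerD2r.
    by apply: aM; exists w.
  split => //; apply: ge_sup; first by exists (g z - l * `|a - z|), z.
  move=> _ [w Uw <-]; rewrite (le_trans (leS a b w))// lerD2r.
  by apply: ub_le_sup; [exact: hb.2|exists w].
have [hx|hx] := pselect (has_sup (S x)).
  have [hy xy] := hS x y hx; have [_ yx] := hS y x hy.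
  move: xy yx; rewrite [`|y - x|]distrC ler_norml /sup_conv -/(S x) -/(S y).
  by move=> *; apply/andP; split; lra.
have hy : ~ has_sup (S y) by move=> /hS-/(_ x)[].
by rewrite /sup_conv -/(S x) -/(S y) !sup_out// subrr normr0 mulr_ge0.
Qed.

Variable x : V.
Hypothesis Ux : U x.
Hypothesis gUx : forall y, U y -> g y <= g x + l * `|x - y|.

Let ubx : ubound [set g y - l * `|x - y| | y in U] (g x).
Proof. by move=> _ [y /gUx + <-]; rewrite lerBlDr. Qed.

Lemma sup_conv_eq : sup_conv x = g x.
Proof.
have Sx : [set g y - l * `|x - y| | y in U] (g x) by exists x => //; rewrite subrr normr0 mulr0 subr0.
apply/eqP; rewrite eq_le; apply/andP; split; first by apply: ge_sup => //; exists (g x).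
by apply: ub_le_sup => //; exists (g x).
Qed.

Lemma le_sup_conv y : 0 <= l -> U y -> g y <= sup_conv y.
Proof.
move=> l0 Uy; apply: ub_le_sup; last by exists y => //; rewrite subrr normr0 mulr0 subr0.
exists (g x + l * `|x - y|) => _ [z Uz <-].
have := gUx Uz; have := ler_wpM2l l0 (ler_distD y x z); rewrite mulrDr; lra.
Qed.

End sup_conv.

Lemma qformN (R : realType) n (p : 'rV[rat]_n) (v : 'rV[R]_n) :
  qform p (- v) = - qform p v.
Proof. by rewrite /qform -sumrN; apply: eq_bigr => i _; rewrite mxE mulrN. Qed.

(** [A], [B], [C] are the values at x + w of the upper, lower and squeezed functions, the primed
    letters those at x - w, and [D] is the common value at x. The order at both points forces [P]
    and [Q] to differ by at most [2 * eta * W]; one more error gives [3 * eta]. *)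
Lemma squeeze_bounds (R : realFieldType) (eta e P Q W A A' B B' C C' D : R) :
  0 <= W -> 3 * eta <= e ->
  `|A - D - P| <= eta * W -> `|A' - D + P| <= eta * W ->
  `|B - D - Q| <= eta * W -> `|B' - D + Q| <= eta * W ->
  B <= C <= A -> B' <= C' <= A' -> `|C - D - P| <= e * W.
Proof.
move=> W0 /(ler_wpM2r W0); rewrite !ler_norml => *.
by apply/andP; split; lra.
Qed.

Lemma squeeze_diff_along (R : realType) n (u v g : 'rV[R]_n -> R) x (r : R) : 0 < r ->
  u x = g x -> v x = g x -> (forall y, `|y - x| < r -> v y <= g y <= u y) ->
  diff_along qform idfun u x -> diff_along qform idfun v x ->
  diff_along qform idfun g x.
Proof.
move=> r0 ux vx vgu du dv j.
have [j' jj'] : exists j' : nat, j'.+1%:R^-1 < j.+1%:R^-1 / 3 :> R.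
  by apply: ex_natSinv_lt; rewrite divr_gt0 ?invr_gt0.
have [p [k1 up]] := du j'; have [q [k2 vq]] := dv j'; have [k3 k3r] := ex_natSinv_lt r0.
exists p, (maxn k1 (maxn k2 k3)) => w wk.
have wlt k : (k <= maxn k1 (maxn k2 k3))%N -> `|w| < k.+1%:R^-1.
  by move=> kk; rewrite (lt_le_trans wk)// lef_pV2 ?posrE// ler_nat.
have w1 : `|w| < k1.+1%:R^-1 by apply: wlt; rewrite leq_max leqnn.
have w2 : `|w| < k2.+1%:R^-1 by apply: wlt; rewrite !leq_max leqnn orbT.
have w3 : `|w| < r.
  by apply: lt_trans k3r; apply: wlt; rewrite !leq_max leqnn !orbT.
have E1 := up w w1; have E2 := vq w w2.
have E3 := up (- w); rewrite normrN qformN opprK ux in E3.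
have E4 := vq (- w); rewrite normrN qformN opprK vx in E4.
rewrite ux in E1; rewrite vx in E2.
apply: (squeeze_bounds _ _ E1 (E3 w1) E2 (E4 w2)) => //.
- by rewrite mulrC -ler_pdivlMr// ltW.
- by apply: vgu; rewrite addrAC subrr add0r.
- by apply: vgu; rewrite addrAC subrr add0r normrN.
Qed.

(** Rational balls and integer slopes give countably many pairs of envelopes, each differentiable
    almost everywhere by Rademacher's theorem. Where [g] is Lipschitz at x, some pair encloses [g]
    near x and touches it at x. *)
Theorem stepanov (R : realType) n (g : 'rV[R]_n -> R) :
  (borel_lebesgue_rV n).-negligible
   [set x : 'rV[R]_n | (exists k, forall y, `|y - x| < k.+1%:R^-1 ->
       `|g y - g x| <= k.+1%:R * `|y - x|) /\ ~ diff_along qform idfun g x].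
Proof.
pose U (i : 'rV[rat]_n * nat) : set 'rV[R]_n := ball (map_mx ratr i.1 : 'rV[R]_n) i.2.+1%:R^-1.
pose u (i : 'rV[rat]_n * nat * nat) := sup_conv g (U i.1) i.2.+1%:R.
pose v (i : 'rV[rat]_n * nat * nat) x := - sup_conv (fun y => - g y) (U i.1) i.2.+1%:R x.
have uL i x y : `|u i x - u i y| <= i.2.+1%:R * `|x - y| by exact: sup_conv_lipschitz.
have vL i x y : `|v i x - v i y| <= i.2.+1%:R * `|x - y|.
  by rewrite /v -opprD normrN; exact: sup_conv_lipschitz.
have key : (borel_lebesgue_rV n).-negligible (\bigcup_i
    (~` diff_along qform idfun (u i) `|` ~` diff_along qform idfun (v i))).
  apply: negligible_countable_bigcup => i.
  by apply: negligibleU; [exact: rademacher (uL i)|exact: rademacher (vL i)].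
apply: negligibleS key => x [[m gm] ngx].
have m2 : (0 : R) < m.+1%:R^-1 / 2 by rewrite divr_gt0 ?invr_gt0.
(* With radius below half of [m.+1%:R^-1], a rational ball containing [x] stays in the region where
   the Lipschitz bound at [x] holds. *)
have [k km] := ex_natSinv_lt m2.
have k0 : (0 : R) < k.+1%:R^-1 by rewrite invr_gt0.
have [q qx] := rV_rat_dense x k0.
have Ux : U (q, k) x by rewrite /U -ball_normE /= distrC.
have Um y : U (q, k) y -> `|y - x| < m.+1%:R^-1.
  rewrite /U -ball_normE /= => qy; rewrite (le_lt_trans (ler_distD (map_mx ratr q) _ _))//.
  by rewrite (splitr m.+1%:R^-1) ltrD// 1?distrC (lt_trans _ km)// distrC.
have [r r0 rU] : exists2 r : R, 0 < r & forall y, `|y - x| < r -> U (q, k) y.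
  have /nbhs_ballP[r /= r0 rU] : nbhs x (U (q, k)).
    by apply: open_nbhs_nbhs; split => //; exact: ball_open.
  by exists r => // y yx; apply: rU; rewrite -ball_normE /= distrC.
apply: contrapT => nN; apply: ngx.
have gmU y : U (q, k) y -> g x - m.+1%:R * `|x - y| <= g y <= g x + m.+1%:R * `|x - y|.
  by move=> /Um/gm; rewrite [`|x - y|]distrC ler_norml; lra.
have h1 y : U (q, k) y -> g y <= g x + m.+1%:R * `|x - y| by move=> /gmU/andP[].
have h2 y : U (q, k) y -> - g y <= - g x + m.+1%:R * `|x - y| by move=> /gmU; lra.
apply: (squeeze_diff_along (u := u (q, k, m)) (v := v (q, k, m)) r0).
- exact: sup_conv_eq.
- by rewrite /v sup_conv_eq// opprK.
- move=> y /rU Uy; apply/andP; split; last exact: le_sup_conv h1 _ _ Uy.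
  by rewrite /v lerNl; exact: le_sup_conv h2 _ _ Uy.
- by apply: contrapT => H; apply: nN; exists (q, k, m) => //; left.
- by apply: contrapT => H; apply: nN; exists (q, k, m) => //; right.
Qed.

(** * Lipschitz estimates for suprema of averages *)

Section enorm.
Context {R : realType} {n : nat}.
Implicit Types u v x y z : 'rV[R]_n.

Definition enorm v : R := Num.sqrt (\sum_i v ord0 i ^+ 2).

Lemma enorm_ge0 v : 0 <= enorm v.
Proof. exact: sqrtr_ge0. Qed.

Lemma sqr_enorm v : enorm v ^+ 2 = \sum_i v ord0 i ^+ 2.
Proof. by rewrite sqr_sqrtr// sumr_ge0// => i _; rewrite sqr_ge0. Qed.

Lemma enormN v : enorm (- v) = enorm v.
Proof. by congr Num.sqrt; apply: eq_bigr => i _; rewrite mxE sqrrN. Qed.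

Lemma enorm_distrC x y : enorm (x - y) = enorm (y - x).
Proof. by rewrite -enormN opprB. Qed.

Lemma le_norm_enorm v : `|v| <= enorm v.
Proof.
apply: rV_norm_le => [|i]; first exact: enorm_ge0.
rewrite -(@ler_pXn2r _ 2) ?nnegrE ?enorm_ge0// sqr_enorm real_normK ?num_real//.
by rewrite (bigD1 i)//= lerDl sumr_ge0// => j _; rewrite sqr_ge0.
Qed.

Lemma enorm_le_norm v : enorm v <= n%:R * `|v|.
Proof.
rewrite -(@ler_pXn2r _ 2) ?nnegrE ?enorm_ge0 ?mulr_ge0// sqr_enorm.
have H i : v ord0 i ^+ 2 <= `|v| ^+ 2.
  rewrite -[leLHS]real_normK ?num_real// ler_pXn2r ?nnegrE//.
  exact: rV_coord_le.
rewrite (le_trans (ler_sum _ (fun i _ => H i)))// sumr_const card_ord.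
rewrite exprMn -[leLHS]mulr_natl ler_wpM2r ?sqr_ge0// -natrX ler_nat.
by case: (n) => // m; rewrite leq_pmull.
Qed.

(** Expanding the sum of the squares of [u_i * B - v_i * A] gives the claim multiplied by
    [2 * (A * B)]; if this factor vanishes, one of the vectors is zero. *)
Lemma cauchy_schwarz u v : \sum_i u ord0 i * v ord0 i <= enorm u * enorm v.
Proof.
set A := enorm u; set B := enorm v; set S := \sum_i _.
have A0 : 0 <= A by exact: enorm_ge0.
have B0 : 0 <= B by exact: enorm_ge0.
have key : 0 <= 2 * (A * B) * (A * B - S).
  have : 0 <= \sum_i (u ord0 i * B - v ord0 i * A) ^+ 2 by apply: sumr_ge0 => i _; exact: sqr_ge0.
  have -> : \sum_i (u ord0 i * B - v ord0 i * A) ^+ 2 =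
      \sum_i (u ord0 i ^+ 2 * B ^+ 2 + u ord0 i * v ord0 i * (- (2 * (A * B))) +
        v ord0 i ^+ 2 * A ^+ 2).
    by apply: eq_bigr => i _; ring.
  rewrite !big_split/= -!mulr_suml -!sqr_enorm -/A -/B -/S.
  suff -> : A ^+ 2 * B ^+ 2 + S * (- (2 * (A * B))) + B ^+ 2 * A ^+ 2 =
    2 * (A * B) * (A * B - S) by [].
  by ring.
have [AB0|AB0] := eqVneq (A * B) 0; last first.
  by rewrite -subr_ge0; move: key; rewrite pmulr_rge0// mulr_gt0// lt_neqAle eq_sym AB0 mulr_ge0.
move/eqP: AB0; rewrite mulf_eq0 => /orP[/eqP A00|/eqP B00].
  have u0 i : u ord0 i = 0.
    by apply/eqP; rewrite -normr_eq0 eq_le normr_ge0 andbT (le_trans (rV_coord_le u i))// (le_trans (le_norm_enorm u))// -/A A00.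
  by rewrite A00 mul0r /S big1// => i _; rewrite u0 mul0r.
have v0 i : v ord0 i = 0.
  by apply/eqP; rewrite -normr_eq0 eq_le normr_ge0 andbT (le_trans (rV_coord_le v i))// (le_trans (le_norm_enorm v))// -/B B00.
by rewrite B00 mulr0 /S big1// => i _; rewrite v0 mulr0.
Qed.

Lemma enormD u v : enorm (u + v) <= enorm u + enorm v.
Proof.
rewrite -(@ler_pXn2r _ 2) ?nnegrE ?addr_ge0 ?enorm_ge0//.
rewrite sqr_enorm sqrrD !sqr_enorm.
rewrite (_ : \sum_i _ = \sum_i u ord0 i ^+ 2 + (\sum_i u ord0 i * v ord0 i) *+ 2 + \sum_i v ord0 i ^+ 2).
  by rewrite lerD2r lerD2l lerMn2r cauchy_schwarz orbT.
rewrite -sumrMnl -!big_split/=; apply: eq_bigr => i _.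
by rewrite mxE sqrrD.
Qed.

Lemma enorm_distD z x y : enorm (x - y) <= enorm (x - z) + enorm (z - y).
Proof. by rewrite (le_trans _ (enormD _ _))// addrA subrK. Qed.

Lemma enorm0 : enorm 0 = 0.
Proof. by rewrite /enorm big1 ?sqrtr0// => i _; rewrite mxE expr0n. Qed.

Lemma enorm_eq0 v : enorm v = 0 -> v = 0.
Proof.
by move=> v0; apply/normr0_eq0/eqP; rewrite eq_le normr_ge0 andbT -v0 le_norm_enorm.
Qed.

Lemma euclidean_ballE x r : euclidean_ball x r = [set y | enorm (y - x) < r].
Proof.
have H y : \sum_i (y ord0 i - x ord0 i) ^+ 2 = \sum_i (y - x) ord0 i ^+ 2.
  by apply: eq_bigr => i _; rewrite !mxE.
by apply/seteqP; split => y; rewrite /euclidean_ball /enorm /= H.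
Qed.

End enorm.

(** By convexity the power lies below its chord on [0, 1], whose slope [2 ^+ n - 1] is rounded up at
    the end. *)
Lemma expr1D_le (R : realFieldType) n (t : R) : 0 <= t <= 1 -> (1 + t) ^+ n <= 1 + 2 ^+ n * t.
Proof.
move=> /andP[t0 t1].
suff H : (1 + t) ^+ n <= 1 + (2 ^+ n - 1) * t.
  by rewrite (le_trans H)// lerD2l ler_wpM2r// lerBlDr lerDl.
elim: n => [|n IH]; first by rewrite !expr0 subrr mul0r addr0.
rewrite exprS (le_trans (ler_wpM2l _ IH)) ?addr_ge0//.
have : 1 <= 2 ^+ n :> R by rewrite exprn_ege1// ler1n.
rewrite [2 ^+ n.+1]exprS; move: (2 ^+ n) => c c1.
have : 0 <= (c - 1) * (t * (1 - t)) by rewrite !mulr_ge0// subr_ge0.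
lra.
Qed.

(* In the first clause [F + k] is integrated over the ball of centre [x] and radius
   [r], which is included in the one of centre [y] and radius [r + h]. *)
Definition average_like (R : realType) n (F : 'rV[R]_n -> R) (a : 'rV[R]_n -> R -> R) :=
  [/\ forall x y r h k, 0 < r -> enorm (x - y) <= h ->
        (forall z, enorm (z - y) < r + h -> 0 <= F z + k) ->
        a x r + k <= (1 + h / r) ^+ n * (a y (r + h) + k),
      forall x r M, 0 < r -> (forall z, enorm (z - x) < r -> F z <= M) -> a x r <= M,
      forall x r m, 0 < r -> (forall z, enorm (z - x) < r -> m <= F z) -> m <= a x r &
      forall x, 0 <= F x].

Definition sup_average (R : realType) n (a : 'rV[R]_n -> R -> R) x : R :=
  sup [set a x r | r in [set r | 0 < r]].

Section maximal_lipschitz.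
Context {R : realType} {n : nat}.
Variables (F : 'rV[R]_n -> R) (a : 'rV[R]_n -> R -> R).
Hypothesis aF : average_like F a.
Implicit Types (x y z : 'rV[R]_n) (r m h L d : R).

Let a_ge0 x r : 0 < r -> 0 <= a x r.
Proof. by move=> r0; case: aF => _ _ H F0; apply: H => // z _; exact: F0. Qed.

Let a_cmp x y r h m : 0 < r -> enorm (x - y) <= h ->
  (forall r, 0 < r -> a y r <= m) -> a x r <= (1 + h / r) ^+ n * m.
Proof.
move=> r0 xyh ym; have h0 : 0 <= h by rewrite (le_trans _ xyh)// enorm_ge0.
have [H _ _ F0] := aF.
have := H x y r h 0 r0 xyh (fun z _ => _); rewrite !addr0 => /(_ _)/le_trans; apply.
  by move=> z; rewrite addr0.
apply: ler_wpM2l; last by rewrite ym// ltr_wpDr.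
by rewrite exprn_ge0// addr_ge0// divr_ge0// ltW.
Qed.

(** For radii at least [d], the factor [(1 + h / r) ^+ n] exceeds 1 by at most [2 ^+ n * (h / d)],
    which is linear in the displacement. *)
Let a_cmp_far x y r h d m : 0 < d -> d <= r -> h <= d -> enorm (x - y) <= h ->
  0 <= m -> (forall r, 0 < r -> a y r <= m) -> a x r <= m + 2 ^+ n / d * m * h.
Proof.
move=> d0 dr hd xyh m0 ym; have h0 : 0 <= h by rewrite (le_trans _ xyh)// enorm_ge0.
have r0 : 0 < r by rewrite (lt_le_trans d0).
rewrite (le_trans (a_cmp r0 xyh ym))//.
have hrd : h / r <= h / d by rewrite ler_wpM2l// lef_pV2 ?posrE.
have hr1 : 0 <= h / r <= 1.
  by rewrite divr_ge0 ?(ltW r0)//= ler_pdivrMr// mul1r (le_trans hd).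
rewrite (le_trans (ler_wpM2r m0 (expr1D_le n hr1)))//.
rewrite mulrDl mul1r lerD2l (_ : 2 ^+ n / d * m * h = 2 ^+ n * (h / d) * m); last by ring.
by rewrite ler_wpM2r// ler_wpM2l// exprn_ge0.
Qed.

Variables (x : 'rV[R]_n) (L d : R).
Hypotheses (L0 : 0 <= L) (d0 : 0 < d).
Hypothesis FL : forall z, enorm (z - x) < d -> `|F z - F x| <= L * enorm (z - x).

(** Radii below [d] are controlled by the Lipschitz bound at [x], the others by inclusion in balls
    centred at [x0]. *)
Lemma average_bounded x0 m : (forall r, 0 < r -> a x0 r <= m) ->
  exists M, forall r, 0 < r -> a x r <= M.
Proof.
move=> m0; have [H1 H2 _ F0] := aF; pose h := enorm (x - x0).
have m_ge0 : 0 <= m by rewrite (le_trans (a_ge0 x0 ltr01))// m0.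
have h0 : 0 <= h by exact: enorm_ge0.
exists (F x + L * d + (1 + h / d) ^+ n * m) => r r0.
have [rd|dr] := ltP r d.
  rewrite (@le_trans _ _ (F x + L * d))//; last first.
    by rewrite lerDl mulr_ge0// exprn_ge0// addr_ge0// divr_ge0// ltW.
  apply: H2 => // z zr; have zd := lt_trans zr rd.
  have := FL zd; rewrite ler_norml => /andP[_].
  have := ler_wpM2l L0 (ltW zd); lra.
have hrd : h / r <= h / d by rewrite ler_wpM2l// lef_pV2 ?posrE.
apply: (le_trans (a_cmp r0 (lexx h) m0)).
apply: (@le_trans _ _ ((1 + h / d) ^+ n * m)); last first.
  by rewrite lerDr addr_ge0// mulr_ge0// ltW.
apply: ler_wpM2r => //; apply: lerXn2r; last by rewrite lerD2l.
- by rewrite nnegrE addr_ge0// divr_ge0// ltW.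
- by rewrite nnegrE addr_ge0// divr_ge0// ltW.
Qed.

Variable M : R.
Hypothesis aM : forall r, 0 < r -> a x r <= M.

(** On small balls around [x] the function, and with it its average, is at least [F x - e]. *)
Lemma le_F_average : F x <= M.
Proof.
have [_ _ H3 F0] := aF.
apply/ler_addgt0Pr => e e0.
pose r := Num.min d (e / (L + 1)).
have r0 : 0 < r by rewrite lt_min d0 divr_gt0// ltr_wpDl.
suff : F x - e <= a x r by rewrite lerBlDr => /le_trans; apply; rewrite lerD2r aM.
apply: H3 => // z zr.
have zd : enorm (z - x) < d by rewrite (lt_le_trans zr)// ge_min lexx.
have := FL zd; rewrite ler_norml => /andP[+ _].
have : L * enorm (z - x) <= e.
  rewrite (@le_trans _ _ ((L + 1) * enorm (z - x)))//.
    by rewrite ler_wpM2r ?enorm_ge0// lerDl.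
  by rewrite mulrC -ler_pdivlMr ?ltr_wpDl// ltW// (lt_le_trans zr)// ge_min lexx orbT.
lra.
Qed.

(* If [M] exceeds [F x], then by continuity of [F] the small radii do not contribute
   to the supremum near [x]. *)
Lemma small_radii e : 0 < e -> exists2 d' : R, 0 < d' &
  forall y r, 0 < r <= d' -> enorm (y - x) <= d' -> a y r <= F x + e.
Proof.
move=> e0; have [_ H2 _ F0] := aF.
pose r0 := Num.min d (e / (L + 1)).
have r00 : 0 < r0 by rewrite lt_min d0 divr_gt0// ltr_wpDl.
exists (r0 / 2); first by rewrite divr_gt0.
move=> y r /andP[rp rr] yr; apply: H2 => // z zr.
have zr0 : enorm (z - x) < r0.
  rewrite (le_lt_trans (enorm_distD y _ _))//.
  by rewrite [ltRHS]splitr ltr_leD// (lt_le_trans zr).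
have zd : enorm (z - x) < d by rewrite (lt_le_trans zr0)// ge_min lexx.
have := FL zd; rewrite ler_norml => /andP[_].
have : L * enorm (z - x) <= e.
  rewrite (@le_trans _ _ ((L + 1) * enorm (z - x)))//.
    by rewrite ler_wpM2r ?enorm_ge0// lerDl.
  by rewrite mulrC -ler_pdivlMr ?ltr_wpDl// ltW// (lt_le_trans zr0)// ge_min lexx orbT.
lra.
Qed.

(* At intermediate radii the constant [F x] has to be subtracted from [F] before
   comparing averages: only the oscillation of [F], of order [r], gets multiplied by
   [(1 + h / r) ^ n - 1]. *)
Lemma average_upper_eq : M = F x -> exists C d' : R, [/\ 0 <= C, 0 < d' &
  forall y r, 0 < r -> enorm (y - x) < d' -> a y r <= M + C * enorm (y - x)].
Proof.
move=> MF; have [H1 H2 _ F0] := aF.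
have M0 : 0 <= M by rewrite MF.
have d2 : 0 < d / 2 by rewrite divr_gt0.
have C1 : 0 <= 2 ^+ n / (d / 2) * M by rewrite !mulr_ge0// ?exprn_ge0// invr_ge0 ltW.
have C2 : 0 <= 2 ^+ n * 2 * L :> R by rewrite !mulr_ge0// exprn_ge0.
(* The three terms pay, in this order, for the radii [d / 2 <= r], [h < r < d / 2] and [r <= h]. *)
exists (2 ^+ n / (d / 2) * M + 2 ^+ n * 2 * L + 2 * L), (d / 2); split => //.
  by rewrite !addr_ge0// mulr_ge0.
move=> y r r0; set h := enorm (y - x) => hd.
have h0 : 0 <= h by exact: enorm_ge0.
have C1h := mulr_ge0 C1 h0; have C2h := mulr_ge0 C2 h0.
have C3h : 0 <= 2 * L * h by rewrite !mulr_ge0.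
have [rh|hr] := leP r h.
  apply: H2 => // z zr.
  have zh : enorm (z - x) <= 2 * h.
    by rewrite (le_trans (enorm_distD y _ _))// -/h; lra.
  have zd : enorm (z - x) < d by lra.
  have := FL zd; rewrite ler_norml => /andP[_].
  have := ler_wpM2l L0 zh; rewrite !mulrDl; lra.
have [rd|dr] := ltP r (d / 2); last first.
  have := a_cmp_far d2 dr (ltW hd) (lexx _) M0 aM; rewrite -/h !mulrDl; lra.
have hr1 : 0 <= h / r <= 1.
  by rewrite divr_ge0 ?(ltW r0)//= ler_pdivrMr// mul1r ltW.
have Fz (z : 'rV[R]_n) : enorm (z - x) < r + h -> 0 <= F z + (2 * L * r - F x).
  move=> zr; have zd : enorm (z - x) < d by lra.
  have zr2 : enorm (z - x) <= 2 * r by lra.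
  have := FL zd; rewrite ler_norml => /andP[+ _].
  by have := ler_wpM2l L0 zr2; lra.
have Lr : 0 <= 2 * L * r by rewrite !mulr_ge0// ltW.
have K : a x (r + h) + (2 * L * r - F x) <= 2 * L * r.
  by have := aM (ltr_wpDr h0 r0); lra.
have := H1 y x r h _ r0 (lexx _) Fz.
move=> /le_trans/(_ (ler_wpM2l _ K)).
rewrite exprn_ge0 ?addr_ge0// ?(andP hr1).1// => /(_ isT).
move=> /le_trans/(_ (ler_wpM2r Lr (expr1D_le n hr1))).
have -> : (1 + 2 ^+ n * (h / r)) * (2 * L * r) = 2 * L * r + 2 ^+ n * 2 * L * h.
  by field; rewrite gt_eqF.
rewrite !mulrDl; lra.
Qed.

Lemma average_upper_lt : F x < M -> exists C d' : R, [/\ 0 <= C, 0 < d' &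
  forall y r, 0 < r -> enorm (y - x) < d' -> a y r <= M + C * enorm (y - x)].
Proof.
move=> FM; have M0 : 0 <= M by rewrite (le_trans _ (aM ltr01))// a_ge0.
have e0 : 0 < M - F x by rewrite subr_gt0.
have [d' d'0 small] := small_radii e0.
have C0 : 0 <= 2 ^+ n / d' * M by rewrite !mulr_ge0// ?exprn_ge0// invr_ge0 ltW.
exists (2 ^+ n / d' * M), d'; split => // y r r0 yd.
have [rd|/ltW dr] := leP r d'.
  have := small y r; rewrite r0 rd => /(_ isT (ltW yd)).
  have := mulr_ge0 C0 (enorm_ge0 (y - x)); lra.
exact: a_cmp_far dr (ltW yd) (lexx _) M0 aM.
Qed.

Lemma average_upper : exists C d' : R, [/\ 0 <= C, 0 < d' &
  forall y r, 0 < r -> enorm (y - x) < d' -> a y r <= M + C * enorm (y - x)].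
Proof.
have := le_F_average; rewrite le_eqVlt => /orP[/eqP/esym|]; first exact: average_upper_eq.
exact: average_upper_lt.
Qed.

(** If [M = F x], the average of radius [h] around [y] is already large enough. Otherwise only large
    radii matter at [x], and they are compared with averages at [y]; [N <= M + 1] keeps the constant
    independent of [N]. *)
Lemma average_lower : (forall N, (forall r, 0 < r -> a x r <= N) -> M <= N) ->
  exists C d' : R, [/\ 0 <= C, 0 < d' &
  forall y N, enorm (y - x) < d' -> (forall r, 0 < r -> a y r <= N) -> N <= M + 1 ->
    M <= N + C * enorm (y - x)].
Proof.
move=> Mle; have [_ _ H3 F0] := aF.
have M0 : 0 <= M by rewrite (le_trans _ (aM ltr01))// a_ge0.
have := le_F_average; rewrite le_eqVlt => /orP[/eqP FM|FM].
  exists (2 * L), (d / 2); split; [by rewrite mulr_ge0|by rewrite divr_gt0|].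
  move=> y N; set h := enorm (y - x) => hd yN _.
  (* The witness is the average of radius [h], which must be positive, so [y = x] is treated
     apart. *)
  have [h0|h0] := eqVneq h 0.
    have yx : y = x by apply/eqP; rewrite -subr_eq0; apply/eqP/enorm_eq0.
    by rewrite h0 mulr0 addr0; apply: Mle => r r0; rewrite -yx yN.
  have hp : 0 < h by rewrite lt_neqAle eq_sym h0 enorm_ge0.
  suff : F x - 2 * L * h <= a y h by have := yN h hp; lra.
  apply: H3 => // z zh.
  have zh2 : enorm (z - x) <= 2 * h.
    by rewrite (le_trans (enorm_distD y _ _))// -/h; lra.
  have zd : enorm (z - x) < d by lra.
  have := FL zd; rewrite ler_norml => /andP[+ _].
  by have := ler_wpM2l L0 zh2; lra.
(* Half the gap keeps the averages over small radii strictly below [M], so they cannot account for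
   the least bound [M]. *)
have e0 : 0 < (M - F x) / 2 by rewrite divr_gt0// subr_gt0.
have [d' d'0 small] := small_radii e0.
have C0 : 0 <= 2 ^+ n / d' * (M + 1) by rewrite !mulr_ge0 ?addr_ge0 ?exprn_ge0 ?invr_ge0 ?(ltW d'0).
exists (2 ^+ n / d' * (M + 1)), d'; split => //.
move=> y N yd yN NM; rewrite leNgt; apply/negP => lt.
set h := enorm (y - x) in yd lt *.
have h0 : 0 <= h by exact: enorm_ge0.
have N0 : 0 <= N by rewrite (le_trans _ (yN _ ltr01))// a_ge0.
have : M <= Num.max (F x + (M - F x) / 2) (N + 2 ^+ n / d' * (M + 1) * h).
  apply: Mle => r r0; rewrite le_max; apply/orP.
  have [rd|/ltW dr] := leP r d'.
    by left; apply: small; rewrite ?r0 ?rd// subrr enorm0 ltW.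
  right; have xy : enorm (x - y) <= h by rewrite enorm_distrC.
  rewrite (le_trans (a_cmp_far d'0 dr (ltW yd) xy N0 yN))// lerD2l.
  apply: ler_wpM2r => //; apply: ler_wpM2l => //.
  by rewrite mulr_ge0 ?exprn_ge0 ?invr_ge0 ?(ltW d'0).
by rewrite le_max => /orP[]; lra.
Qed.

End maximal_lipschitz.

Theorem sup_average_lipschitz (R : realType) n (F : 'rV[R]_n -> R) a x0 m x L d :
  average_like F a -> (forall r, 0 < r -> a x0 r <= m) -> 0 < d ->
  (forall z, enorm (z - x) < d -> `|F z - F x| <= L * enorm (z - x)) ->
  exists C d' : R, [/\ 0 <= C, 0 < d' & forall y, enorm (y - x) < d' ->
    (exists N, forall r, 0 < r -> a y r <= N) /\
    `|sup_average a y - sup_average a x| <= C * enorm (y - x)].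
Proof.
move=> aF m0 d0 FL'.
have L0 : 0 <= `|L| by [].
have FL z : enorm (z - x) < d -> `|F z - F x| <= `|L| * enorm (z - x).
  by move=> /FL'/le_trans; apply; rewrite ler_wpM2r ?enorm_ge0// ler_norm.
have [N xN] := average_bounded aF L0 d0 FL m0.
have S0 y : [set a y r | r in [set r | 0 < r]] (a y 1) by exists 1; rewrite /= ?ltr01.
have le_sup y K : (forall r, 0 < r -> a y r <= K) ->
    forall r, 0 < r -> a y r <= sup_average a y.
  by move=> yK r r0; apply: ub_le_sup; [exists K => _ [r' /yK + <-]|exists r].
have sup_le y K : (forall r, 0 < r -> a y r <= K) -> sup_average a y <= K.
  by move=> yK; apply: ge_sup; [exists (a y 1)|move=> _ [r /yK + <-]].
have xs := le_sup _ _ xN.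
have [C1 [d1 [C10 d10 H1]]] := average_upper aF L0 d0 FL xs.
have [C2 [d2 [C20 d20 H2]]] := average_lower aF L0 d0 FL xs (@sup_le x).
(* Within [d3] the upper estimate exceeds the supremum at [x] by at most 1, as the lower estimate
   requires. *)
pose d3 := (C1 + 1)^-1.
have C11 : 0 < C1 + 1 by rewrite ltr_wpDl.
exists (C1 + C2), (Num.min d1 (Num.min d2 d3)); split.
- by rewrite addr_ge0.
- by rewrite !lt_min d10 d20 invr_gt0.
move=> y; rewrite !lt_min => /and3P[y1 y2 y3].
have yb r (r0 : 0 < r) := H1 y r r0 y1.
split; first by exists (sup_average a x + C1 * enorm (y - x)).
have ys := le_sup _ _ yb; have U := sup_le _ _ yb.
have C1y : C1 * enorm (y - x) <= 1.
  rewrite (@le_trans _ _ ((C1 + 1) * enorm (y - x)))//.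
    by rewrite ler_wpM2r ?enorm_ge0// lerDl.
  by rewrite mulrC -ler_pdivlMr// div1r ltW.
have Lo := H2 y _ y2 ys (le_trans U _).
have {}Lo := Lo ltac:(by rewrite lerD2l).
have h1 := mulr_ge0 C10 (enorm_ge0 (y - x)).
have h2 := mulr_ge0 C20 (enorm_ge0 (y - x)).
by rewrite ler_norml mulrDl; apply/andP; split; lra.
Qed.

(** * Volume of Euclidean balls *)

Lemma mule_scale (R : realDomainType) (c d e : R) (x y : \bar R) : c * (d * e) = 1 ->
  (c%:E * ((d%:E * x) * (e%:E * y)) = x * y)%E.
Proof. by move=> cde; rewrite muleACA muleA -!EFinM cde mul1e. Qed.

Section scaling.
Context {R : realType}.
Local Notation mu := (@lebesgue_measure R).

(** The pushforward by the affine map, multiplied by [a], gives half-open intervals their length,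
    hence is Lebesgue measure. *)
Lemma lebesgue_measure_affine (a b : R) (A : set (measurableTypeR R)) : 0 < a -> measurable A ->
  (mu ((fun s => a * s + b)%R @^-1` A) = a^-1%:E * mu A)%E.
Proof.
move=> a0 mA.
have mf : measurable_fun [set: measurableTypeR R] (fun s : measurableTypeR R => a * s + b : measurableTypeR R).
  by apply: measurable_funD => //; exact: measurable_funM.
pose m : {measure set (measurableTypeR R) -> \bar R} :=
  measure_function_pushforward__canonical__measure_function_Measure mu mf.
have a0' : 0 <= a by exact: ltW.
pose m' := mscale (NngNum a0') m.
suff E : mu A = m' A.
  rewrite E /m' /mscale /= muleA -EFinM mulVf ?gt_eqF// mul1e.
  by [].
apply: lebesgue_measure_unique => // X [[u v] _ <-].
have preE : (fun s : R => a * s + b) @^-1` `]u, v] = `](u - b) / a, (v - b) / a]%classic.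
  apply/seteqP; split => s /=; rewrite !in_itv/= ltr_pdivrMr// ler_pdivlMr// mulrC.
    by rewrite ltrBlDr lerBrDr.
  by rewrite ltrBlDr lerBrDr.
transitivity (a%:E * mu ((fun s : R => a * s + b)%R @^-1` `]u, v]))%E => //; rewrite preE.
rewrite (lebesgue_measure_itv `]u, v]) (lebesgue_measure_itv `](u - b) / a, (v - b) / a])/=.
rewrite !lte_fin ltr_pM2r ?invr_gt0// ltrD2r; case: ifP => uv; last by rewrite mule0.
by rewrite -!EFinB -EFinM; congr EFin; field; rewrite gt_eqF.
Qed.

Lemma measurable_fun_rV d (T : measurableType d) n (f : T -> 'rV[measurableTypeR R]_n) :
  (forall i, measurable_fun [set: T] (fun t => f t ord0 i)) -> measurable_fun [set: T] f.
Proof.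
move=> mf _ A mA; suff : image_set_system setT f measurable A by [].
move: A mA; apply: smallest_sub; first exact/sigma_algebra_image/sigma_algebra_measurable.
rewrite -bigcup_seq => B [i _ [C mC <-]].
by rewrite /image_set_system /= !setTI; have := mf i measurableT C mC; rewrite setTI.
Qed.

Lemma measurable_rV_affine n (a : R) (b : 'rV[R]_n) :
  measurable_fun [set: 'rV[measurableTypeR R]_n]
    (fun y : 'rV[measurableTypeR R]_n => (a *: (y : 'rV[R]_n) + b) : 'rV[measurableTypeR R]_n).
Proof.
apply: measurable_fun_rV => i.
under eq_fun do rewrite mxE mxE.
apply: measurable_funD => //; apply: measurable_funM => //.
exact: measurable_rV_coord.
Qed.

(** By induction on the dimension: the rescaled pushforward of the product measure has the right
    values on rectangles, which determine it. *)
Lemma borel_lebesgue_rV_affine n (a : R) (b : 'rV[R]_n) (A : set 'rV[measurableTypeR R]_n) :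
  0 < a -> measurable A ->
  (borel_lebesgue_rV n ((fun y : 'rV[R]_n => a *: y + b)%R @^-1` A) =
   (a^-1 ^+ n)%:E * borel_lebesgue_rV n A)%E.
Proof.
move=> a0; elim: n b A => [|n IH] b A mA.
  rewrite expr0 mul1e; congr (borel_lebesgue_rV 0 _).
  apply/seteqP; split => y /=; rewrite (_ : a *: y + b = y)//; by apply/rowP => -[].
have [b0 [b' bE]] := cons_rV_surj b.
pose phi (y : 'rV[measurableTypeR R]_n.+1) : 'rV[measurableTypeR R]_n.+1 := a *: (y : 'rV[R]_n.+1) + b.
have a0' : 0 <= a ^+ n.+1 by rewrite exprn_ge0// ltW.
have mphi : measurable_fun setT phi by exact: measurable_rV_affine.
pose psi (p : measurableTypeR R * 'rV[measurableTypeR R]_n) : measurableTypeR R * 'rV[measurableTypeR R]_n :=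
  (a * p.1 + b0, a *: (p.2 : 'rV[R]_n) + b').
have mpsi : measurable_fun setT psi.
  apply/measurable_fun_pairP; split => /=.
    apply: measurable_funD => //; apply: measurable_funM => //; exact: measurable_fst.
  apply: (measurableT_comp (measurable_rV_affine a b')); exact: measurable_snd.
pose pm : {measure set (measurableTypeR R * 'rV[measurableTypeR R]_n) -> \bar R} :=
  (mu \x borel_lebesgue_rV n)%E.
pose m : {measure set (measurableTypeR R * 'rV[measurableTypeR R]_n) -> \bar R} :=
  measure_function_pushforward__canonical__measure_function_Measure pm mpsi.
pose m' := mscale (NngNum a0') m.
have mC : measurable (rV_cons @^-1` A : set (measurableTypeR R * 'rV[measurableTypeR R]_n)).
  by rewrite -[X in measurable X]setTI; exact: measurable_rV_cons.
have E : pm (rV_cons @^-1` A) = m' (rV_cons @^-1` A).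
  apply: product_measure_unique => // B C mB mC'; rewrite /m' /mscale /=.
  have preE : psi @^-1` (B `*` C) =
     ((fun s => a * s + b0)%R @^-1` B) `*` ((fun y : 'rV[R]_n => a *: y + b')%R @^-1` C) by [].
  transitivity ((a ^+ n.+1)%:E * pm (psi @^-1` (B `*` C)))%E => //; rewrite preE.
  have mB' : measurable ((fun s : measurableTypeR R => a * s + b0 : measurableTypeR R)%R @^-1` B).
    rewrite -[X in measurable X]setTI.
    apply: (measurable_funD (f := fun s => a * s) (g := cst b0)) => //.
    exact: measurable_funM.
  have mC'' : measurable ((fun y : 'rV[R]_n => a *: y + b')%R @^-1` C : set 'rV[measurableTypeR R]_n).
    by rewrite -[X in measurable X]setTI; apply: measurable_rV_affine.
  rewrite [pm _](product_measure1E mu (borel_lebesgue_rV n) mB' mC'').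
  transitivity ((a ^+ n.+1)%:E * ((a^-1%:E * mu B) * ((a^-1 ^+ n)%:E * borel_lebesgue_rV n C)))%E.
    by congr (_ * (_ * _))%E; [exact: lebesgue_measure_affine|exact: IH].
  apply: mule_scale.
  by rewrite exprVn exprS mulrACA !mulfV ?mulr1// ?expf_neq0// gt_eqF.
rewrite /= /product_rV /pushforward -/pm E /m' /mscale/= muleA -EFinM.
rewrite exprVn mulVf ?expf_neq0 ?gt_eqF// mul1e /pushforward.
congr (pm _); apply/seteqP.
have H s t : a *: (cons_rV s t : 'rV[R]_n.+1) + b = cons_rV (a * s + b0) (a *: t + b').
  rewrite bE -cons_rVD; congr (_ + _); apply/rowP => i.
  by case: (unliftP ord0 i) => [j ->|->]; rewrite mxE ?cons_rV0 ?cons_rVS ?mxE.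
by split => -[s t] /=; have := H s t; rewrite /cons_rV /psi /= => ->.
Qed.

(** A set of known volume, with which the unit ball is compared. *)
Lemma borel_lebesgue_rV_cube n :
  let C := [set x : 'rV[measurableTypeR R]_n | forall i, x ord0 i \in `]0, 1]%R] in
  measurable C /\ borel_lebesgue_rV n C = 1%E.
Proof.
move=> C; have mC m : measurable [set x : 'rV[measurableTypeR R]_m | forall i, x ord0 i \in `]0, 1]%R].
  rewrite (_ : [set _ | _] = \bigcap_(i in [set: 'I_m])
     ((fun x : 'rV[measurableTypeR R]_m => x ord0 i) @^-1` `]0, 1]%classic)).
    apply: fin_bigcap_measurable => [|i _]; first exact: finite_finset.
    by rewrite -[X in measurable X]setTI; apply: measurable_rV_coord => //; exact: measurable_itv.
  by apply/seteqP; split => x H i => [_|]; exact: H.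
split; first exact: mC.
rewrite {}/C; elim: n => [|n IH].
  by rewrite /= diracE mem_set// => -[].
rewrite /= /product_rV /pushforward (_ : _ @^-1` _ = (`]0, 1]%classic : set (measurableTypeR R)) `*`
   [set x : 'rV[measurableTypeR R]_n | forall i, x ord0 i \in `]0, 1]%R]).
  rewrite [LHS](product_measure1E mu (borel_lebesgue_rV n) (measurable_itv `]0, 1]) (mC n)).
  rewrite -[RHS]mule1; congr (_ * _)%E; last exact: IH.
  by rewrite [LHS](lebesgue_measure_itv `]0, 1])/= lte_fin ltr01 -EFinB subr0.
apply/seteqP; split => [[s t] /= H|[s t] [/= s01 t01] i].
  split; first by have := H ord0; rewrite mxE unlift_none.
  by move=> i; have := H (lift ord0 i); rewrite mxE liftK.
by case: (unliftP ord0 i) => [j ->|->]; rewrite mxE ?liftK ?unlift_none//=; exact: t01.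
Qed.

Lemma enormZ n (a : R) (v : 'rV[R]_n) : 0 <= a -> enorm (a *: v) = a * enorm v.
Proof.
move=> a0; rewrite /enorm (eq_bigr (fun i => a ^+ 2 * v ord0 i ^+ 2)).
  by rewrite -mulr_sumr sqrtrM ?sqr_ge0// sqrtr_sqr ger0_norm.
by move=> i _; rewrite mxE exprMn.
Qed.

Lemma measurable_euclidean_ball n (x : 'rV[R]_n) r :
  measurable (euclidean_ball x r : set 'rV[measurableTypeR R]_n).
Proof.
apply: open_measurable_rV; rewrite euclidean_ballE.
have ec : continuous (fun y : 'rV[R]_n => enorm (y - x)).
  apply: (@lipschitz_continuous_at _ _ _ n%:R) => y z.
  have H u v : enorm (u - x) - enorm (v - x) <= n%:R * `|u - v|.
    rewrite (le_trans _ (enorm_le_norm _))// lerBlDr; exact: enorm_distD.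
  by rewrite ler_norml H andbT lerNl opprB distrC H.
by apply: (@open_comp _ _ _ [set t : R | t < r]) => // ? _; exact: ec.
Qed.

Lemma euclidean_ball_affine n (x : 'rV[R]_n) r : 0 < r -> euclidean_ball x r =
  (fun y : 'rV[R]_n => r^-1 *: y + (- (r^-1 *: x))) @^-1` euclidean_ball 0 1.
Proof.
move=> r0; rewrite !euclidean_ballE; apply/seteqP; split => y /=;
  by rewrite subr0 -scalerBr enormZ ?invr_ge0 ?ltW// mulrC ltr_pdivrMr// mul1r.
Qed.

Lemma lebesgue_rV_borel n (A : set 'rV[measurableTypeR R]_n) : measurable A ->
  lebesgue_rV n A = borel_lebesgue_rV n A.
Proof. by move=> mA; rewrite /lebesgue_rV /completed_measure_extension measurable_mu_extE. Qed.

(** Scaling reduces to the unit ball. Its volume is positive because a dilated ball contains the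
    unit cube, and finite because the ball lies in a larger cube. *)
Lemma lebesgue_rV_euclidean_ball n : exists2 c : R, 0 < c &
  forall (x : 'rV[R]_n) r, 0 < r -> lebesgue_rV n (euclidean_ball x r) = (c * r ^+ n)%:E.
Proof.
have [mC C1] := borel_lebesgue_rV_cube n; set C := [set _ | _] in mC C1.
pose v : \bar R := borel_lebesgue_rV n (euclidean_ball (0 : 'rV[R]_n) 1).
have vE (x : 'rV[R]_n) (r : R) : 0 < r -> borel_lebesgue_rV n (euclidean_ball x r) = ((r ^+ n)%:E * v)%E.
  move=> r0; rewrite (euclidean_ball_affine x r0).
  rewrite borel_lebesgue_rV_affine ?invr_gt0 ?invrK//; exact: measurable_euclidean_ball.
have v0 : (0 <= v)%E by exact: measure_ge0.
have v_gt0 : (0 < v)%E.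
  rewrite lt_neqAle v0 andbT; apply/negP => /eqP v00.
  have : (borel_lebesgue_rV n C <= borel_lebesgue_rV n (euclidean_ball 0 (n%:R + 1)))%E.
    apply: le_measure; rewrite ?inE//; first exact: measurable_euclidean_ball.
    move=> x Cx; rewrite euclidean_ballE /= subr0 (le_lt_trans (enorm_le_norm _))//.
    have x1 : `|x : 'rV[R]_n| <= 1.
      apply: rV_norm_le => // i; have := Cx i; rewrite in_itv/= => /andP[x0 x1].
      by rewrite ger0_norm// ltW.
    by rewrite (le_lt_trans (ler_wpM2l _ x1))// mulr1 ltrDl.
  by rewrite C1 vE ?ltr_wpDl// -v00 mule0 leNgt lte01.
have v_fin : (v < +oo)%E.
  (* The preimage of the unit cube is the set of vectors with all coordinates in []-1, 1]]. *)
  have H : (v <= borel_lebesgue_rV n ((fun y : 'rV[R]_n => 2^-1 *: y + const_mx 2^-1)%R @^-1` C))%E.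
    apply: le_measure; rewrite ?inE//; first exact: measurable_euclidean_ball.
      by rewrite -[X in measurable X]setTI; apply: measurable_rV_affine.
    move=> x; rewrite euclidean_ballE /= subr0 => x1 i; rewrite !mxE in_itv/=.
    have := le_lt_trans (rV_coord_le x i) (le_lt_trans (le_norm_enorm x) x1).
    by rewrite ltr_norml => /andP[h1 h2]; apply/andP; split; lra.
  by rewrite (le_lt_trans H)// borel_lebesgue_rV_affine ?invr_gt0// C1 mule1 ltry.
have vf : v \is a fin_num by rewrite ge0_fin_numE.
exists (fine v); first by rewrite fine_gt0// v_gt0.
move=> x r r0; rewrite lebesgue_rV_borel; last exact: measurable_euclidean_ball.
by rewrite vE// EFinM fineK// muleC.
Qed.
End scaling.

(** * The maximal function *)

Section lebesgue_rV_complete.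
Context {R : realType} {n : nat}.
Local Notation lam := (@lebesgue_rV R n).
Local Notation T := (caratheodory_type (mu_ext (borel_lebesgue_rV n))).

Lemma borel_measurable_lebesgue_rV (A : set 'rV[measurableTypeR R]_n) :
  measurable A -> measurable (A : set T).
Proof. by move=> mA; exact: caratheodory_measurable_mu_ext. Qed.

Lemma borel_negligible_lebesgue_rV (A : set 'rV[measurableTypeR R]_n) :
  (borel_lebesgue_rV n).-negligible A -> lam.-negligible A.
Proof.
move=> [B [mB B0 AB]]; exists B; split => //; first exact: borel_measurable_lebesgue_rV.
by rewrite lebesgue_rV_borel.
Qed.

Lemma lebesgue_rV_complete (A : set T) : lam.-negligible A -> measurable A.
Proof. exact: measure_is_complete_caratheodory. Qed.

(** A superlevel set is its interior together with some points of discontinuity; these form a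
    negligible set, which is measurable by completeness. *)
Lemma ae_continuous_measurable (f : 'rV[R]_n -> R) :
  {ae lam, forall x, {for x, continuous f}} -> measurable_fun [set: T] (f : T -> R).
Proof.
move=> fc; apply: (measurability _ (RGenOInfty.measurableE R)) => //.
move=> /= _ [_ [a ->] <-]; rewrite setTI.
have -> : f @^-1` `]a, +oo[ = (f @^-1` `]a, +oo[)° `|` (f @^-1` `]a, +oo[ `\` (f @^-1` `]a, +oo[)°).
  by rewrite setDUK//; exact: interior_subset.
apply: measurableU.
  apply: borel_measurable_lebesgue_rV; apply: open_measurable_rV; exact: open_interior.
apply: lebesgue_rV_complete; apply: negligibleS fc => x /= [fx nfx] cfx.
apply: nfx; apply: cfx; apply: open_nbhs_nbhs; split => //.
Qed.

End lebesgue_rV_complete.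

Section averages.
Context {R : realType} {n : nat}.
Local Notation lam := (@lebesgue_rV R n).
Local Notation T := (caratheodory_type (mu_ext (borel_lebesgue_rV n))).
Variable f : 'rV[R]_n -> R.
Hypothesis mf : measurable_fun [set: T] (f : T -> R).

Let F (y : 'rV[R]_n) : R := `|f y|.

Definition average (x : 'rV[R]_n) (r : R) : \bar R :=
  ((lam (euclidean_ball x r))^-1 *
    \int[lam]_(y in euclidean_ball x r) `|f y|%:E)%E.

Let mF D : measurable_fun (D : set T) (EFin \o (F : T -> R)).
Proof. by apply/measurable_EFinP/measurable_funTS; exact: measurableT_comp. Qed.

Let mB (x : 'rV[R]_n) r : measurable (euclidean_ball x r : set T).
Proof. by apply: borel_measurable_lebesgue_rV; exact: measurable_euclidean_ball. Qed.

Let sub_ball (x y : 'rV[R]_n) (r h : R) : enorm (x - y) <= h ->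
  euclidean_ball x r `<=` euclidean_ball y (r + h).
Proof.
move=> xyh z; rewrite !euclidean_ballE /= => zx.
by rewrite (le_lt_trans (enorm_distD x _ _))// ltr_leD.
Qed.

Lemma average_ge0 x r : 0 < r -> (0 <= average x r)%E.
Proof.
have [c c0 cE] := lebesgue_rV_euclidean_ball (R := R) n.
move=> r0; rewrite /average cE// inver gt_eqF ?mulr_gt0 ?exprn_gt0//.
apply: mule_ge0; first by rewrite lee_fin invr_ge0 ltW// mulr_gt0// exprn_gt0.
by apply: integral_ge0 => y _; rewrite lee_fin.
Qed.

(** Every ball lies in a ball centred at [x0], so finite averages there make [|f|] integrable on all
    balls. The averages are then real, and the clauses follow from monotonicity of the integral. *)
Lemma average_likeP x0 : (forall r, 0 < r -> (average x0 r < +oo)%E) ->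
  (forall x r, 0 < r -> average x r = (fine (average x r))%:E) /\
  average_like F (fun x r => fine (average x r)).
Proof.
have [c c0 cE] := lebesgue_rV_euclidean_ball (R := R) n.
move=> x0_fin.
have cr r : 0 < r -> 0 < c * r ^+ n by move=> r0; rewrite mulr_gt0// exprn_gt0.
have avE x r : 0 < r -> average x r = ((c * r ^+ n)^-1%:E *
    \int[lam]_(y in euclidean_ball x r) (EFin \o F) y)%E.
  by move=> r0; rewrite /average cE// inver gt_eqF ?cr.
have intF x r : 0 < r -> lam.-integrable (euclidean_ball x r) (EFin \o F).
  move=> r0; apply/integrableP; split; first exact: mF.
  have h0 : 0 <= enorm (x - x0) := enorm_ge0 _.
  have rh : 0 < r + enorm (x - x0) by rewrite ltr_wpDr.
  apply: (@le_lt_trans _ _ (\int[lam]_(y in euclidean_ball x0 (r + enorm (x - x0))) (EFin \o F) y)%E).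
    under eq_integral do rewrite /= normr_id.
    by apply: ge0_subset_integral => //; solve [exact: mF|exact: sub_ball].
  have := x0_fin _ rh; rewrite avE//; apply: contraTT; rewrite -!leNgt !leye_eq => /eqP ->.
  by rewrite gt0_muley// lte_fin invr_gt0 cr.
pose i x r : R := (\int[lam]_(y in euclidean_ball x r) F y)%R.
have avi x r : 0 < r -> average x r = ((c * r ^+ n)^-1 * i x r)%:E.
  move=> r0; rewrite avE// EFinM /i /Rintegral fineK//.
  by apply: integrable_fin_num => //; exact: intF.
have fav x r : 0 < r -> fine (average x r) = (c * r ^+ n)^-1 * i x r.
  by move=> r0; rewrite avi.
split; first by move=> x r r0; rewrite avi.
have intk x r k : 0 < r -> lam.-integrable (euclidean_ball x r) (EFin \o cst k).
  move=> r0; apply/integrableP; split; first exact/measurable_EFinP.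
  rewrite (eq_integral (cst `|k|%:E))//.
  by rewrite integral_cst// [X in (_ * X)%E](cE x r r0) ltry.
have intFk x r k : 0 < r -> lam.-integrable (euclidean_ball x r) (EFin \o (fun y => F y + k)).
  move=> r0; have -> : EFin \o (fun y => F y + k) = ((EFin \o F) \+ (EFin \o cst k))%E by [].
  by apply: integrableD => //; [exact: intF|exact: intk].
have ik x r k : 0 < r -> (\int[lam]_(_ in euclidean_ball x r) k)%R = k * (c * r ^+ n).
  by move=> r0; rewrite Rintegral_cst// [X in fine X](cE x r r0).
have iD x r k : 0 < r ->
    (\int[lam]_(y in euclidean_ball x r) (F y + k))%R = i x r + k * (c * r ^+ n).
  by move=> r0; rewrite RintegralD ?ik//; [exact: intF|exact: intk].
split => //.
- move=> x y r h k r0 xyh Fk; have h0 : 0 <= h by rewrite (le_trans _ xyh)// enorm_ge0.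
  have rh0 : 0 < r + h by rewrite ltr_wpDr.
  rewrite !fav//.
  have : i x r + k * (c * r ^+ n) <= i y (r + h) + k * (c * (r + h) ^+ n).
    rewrite -!iD//; apply: fine_le.
    + exact: integrable_fin_num (intFk x r k r0).
    + exact: integrable_fin_num (intFk y _ k rh0).
    apply: ge0_subset_integral => //; last exact: sub_ball.
      by apply/measurable_EFinP; apply: measurable_funD => //; exact/measurable_EFinP/mF.
    by move=> z; rewrite euclidean_ballE /= => zy; rewrite lee_fin Fk.
  have cr0 := cr _ r0; have crh := cr _ rh0.
  rewrite -(ler_pM2r (_ : 0 < (c * r ^+ n)^-1)) ?invr_gt0//.
  have E1 : (i x r + k * (c * r ^+ n)) / (c * r ^+ n) = (c * r ^+ n)^-1 * i x r + k.
    by rewrite mulrDl mulfK ?gt_eqF// mulrC.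
  (* The factor is the ratio of the volumes of the two balls. *)
  have E2 : (i y (r + h) + k * (c * (r + h) ^+ n)) / (c * r ^+ n) =
      (1 + h / r) ^+ n * ((c * (r + h) ^+ n)^-1 * i y (r + h) + k).
    rewrite (_ : 1 + h / r = (r + h) / r); last by rewrite mulrDl divff ?gt_eqF.
    by rewrite expr_div_n; field; rewrite ?gt_eqF ?exprn_gt0.
  by rewrite E1 E2.
- move=> x r M r0 FM; rewrite fav// mulrC ler_pdivrMr ?cr// -(ik x)//.
  apply: le_Rintegral => //; [exact: intF|exact: intk|].
  by move=> z; rewrite euclidean_ballE /= => /FM.
- move=> x r m r0 Fm; rewrite fav// mulrC ler_pdivlMr ?cr// -(ik x)//.
  apply: le_Rintegral => //; [exact: intk|exact: intF|].
  by move=> z; rewrite euclidean_ballE /= => /Fm.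
- by move=> x; exact: normr_ge0.
Qed.

End averages.

(** The constant is a bound for the differential plus 1 for the remainder. *)
Lemma differentiable_lipschitz_at (R : realType) n (f : 'rV[R]_n -> R) x :
  differentiable f x -> exists L d : R, 0 < d /\
    forall z, enorm (z - x) < d -> `|f z - f x| <= L * enorm (z - x).
Proof.
move=> df; have [k k0 kd] := linear_lipschitz (diff_continuous df).
have /eqaddoP := diff_locally df => /(_ 1 ltr01) /nbhs_ballP[d /= d0 dH].
exists (k + 1), d; split => // z zx.
have zd : `|z - x| < d by rewrite (le_lt_trans (le_norm_enorm _)).
have := dH (z - x); rewrite -ball_normE /= sub0r normrN => /(_ zd).
rewrite !fctE /= subrK mul1r opprD addrA => H1.
have H2 := kd (z - x).
rewrite -[f z - f x](subrK ('d f x (z - x))) (le_trans (ler_normD _ _))//.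
rewrite (le_trans (lerD H1 H2))// addrC -[X in _ + X]mul1r -mulrDl.
by rewrite ler_wpM2l ?le_norm_enorm// addr_ge0// ltW.
Qed.

Theorem theorem3p10 (R : realType) (n : nat) (f : 'rV[R]_n -> R)
  (f_diff : {ae lebesgue_rV n, forall x : 'rV[R]_n, differentiable f x})
  (Mf_neq_infty : HL_maximal_rV f <> cst +oo%E) :
  {ae lebesgue_rV n,
    forall x : 'rV[R]_n, ereal_differentiable (HL_maximal_rV f) x}.
Proof.
(* Measurability of [f] comes from its continuity almost everywhere. *)
have mf : measurable_fun setT
    (f : caratheodory_type (mu_ext (borel_lebesgue_rV n)) -> R).
  apply: ae_continuous_measurable; apply: ae_imp f_diff => x.
  exact: differentiable_continuous.
have [x0 Mx0] : exists x0, HL_maximal_rV f x0 <> +oo%E.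
  by apply/existsNP => H; apply: Mf_neq_infty; apply/funext.
have ltx0 : (HL_maximal_rV f x0 < +oo)%E by rewrite ltey; exact/eqP.
have ge0x0 : (0 <= HL_maximal_rV f x0)%E.
  apply: le_trans (average_ge0 f x0 ltr01) _; apply: ereal_sup_ubound.
  by exists 1 => //; rewrite /= in_itv/= andbT.
have av_le r : 0 < r -> (average f x0 r <= HL_maximal_rV f x0)%E.
  by move=> r0; apply: ereal_sup_ubound; exists r => //; rewrite /= in_itv/= andbT.
have [avE avF] := average_likeP mf (fun r r0 => le_lt_trans (av_le r r0) ltx0).
set F := (fun y : 'rV[R]_n => `|f y|) in avF.
pose a x r := fine (average f x r); rewrite -/a in avF.
have am r : 0 < r -> a x0 r <= fine (HL_maximal_rV f x0).
  by move=> r0; rewrite -lee_fin /a -avE// fineK ?av_le// ge0_fin_numE.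
have ME y : (exists N, forall r, 0 < r -> a y r <= N) ->
    HL_maximal_rV f y = (sup_average a y)%:E.
  move=> [N yN]; rewrite /sup_average -ereal_sup_EFin.
  - congr ereal_sup; apply/seteqP; split => [_ [r + <-]|_ [_ [r /= r0 <-] <-]].
      rewrite /= in_itv/= andbT => r0.
      by exists (a y r); [exists r|rewrite /a -avE].
    by exists r; [rewrite /= in_itv/= andbT|rewrite [RHS]/= /a -avE].
  - by exists N => _ [r /yN + <-].
  - by exists (a y 1), 1 => //=; exact: ltr01.
(* Where [f] is differentiable, its maximal function is finite nearby and Lipschitz at the point; a
   single integer encodes scale and constant, as in [stepanov]. *)
have key x : differentiable f x -> exists k, forall y, `|y - x| < k.+1%:R^-1 ->
    HL_maximal_rV f y \is a fin_num /\
    `|fine (HL_maximal_rV f y) - fine (HL_maximal_rV f x)| <= k.+1%:R * `|y - x|.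
  move=> /differentiable_lipschitz_at[L [d [d0 fL]]].
  have FL z : enorm (z - x) < d -> `|F z - F x| <= L * enorm (z - x).
    by move=> zx; rewrite (le_trans (ler_dist_dist _ _))// fL.
  have [C [d' [C0 d'0 H]]] := sup_average_lipschitz avF am d0 FL.
  (* Passing from [enorm] to the sup norm costs a factor [n]; [n%:R + 1] keeps the denominator
     positive in dimension 0. *)
  have [k0 k0d] : exists k : nat, k.+1%:R^-1 < d' / (n%:R + 1).
    by apply: ex_natSinv_lt; rewrite divr_gt0 ?ltr_wpDl.
  have [|xN _] := H x; first by rewrite subrr enorm0.
  pose k1 := Num.bound (C * n%:R).
  exists (maxn k0 k1) => y yx.
  have yd : enorm (y - x) < d'.
    rewrite (le_lt_trans (enorm_le_norm _))//.
    rewrite (@le_lt_trans _ _ ((n%:R + 1) * `|y - x|)) ?ler_wpM2r ?lerDl//.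
    rewrite mulrC -ltr_pdivlMr ?ltr_wpDl// (lt_trans _ k0d)// (lt_le_trans yx)//.
    by rewrite lef_pV2 ?posrE// ler_nat ltnS leq_maxl.
  have [yN HL] := H y yd.
  rewrite !ME//; split => //=; rewrite (le_trans HL)//.
  rewrite (le_trans (ler_wpM2l C0 (enorm_le_norm _)))// mulrA ler_wpM2r//.
  rewrite (le_trans (ltW (archi_boundP _))) ?mulr_ge0// ler_nat.
  by rewrite leqW// leq_maxr.
have st := borel_negligible_lebesgue_rV (stepanov (fine \o HL_maximal_rV f)).
(* At an exceptional point either [f] is not differentiable, or the maximal function is Lipschitz
   there without being differentiable, which Stepanov's theorem confines to a null set. *)
apply: negligibleS (negligibleU f_diff st) => x nd.
have [df|] := pselect (differentiable f x); last by left.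
right; have [k Hk] := key x df; split.
  by exists k => y /Hk[].
move=> dx; apply: nd; split; last exact: diff_along_differentiable.
apply/nbhs_ballP; exists k.+1%:R^-1; first by rewrite /= invr_gt0.
by move=> y; rewrite -ball_normE /= distrC => /Hk[].
Qed.
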